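(* Let $X$ be a Hilbert space and $V$ a closed convex body (not necessarily bounded) with $S=\partial V$ a $C^1$ submanifold and outer unit normal $N_S:S\to S_X$. Let $\omega$ be a modulus of continuity and $\varphi(t):=\int_0^t\omega(s)\,ds$. The following are equivalent: (1) There is $M>0$ with $\|N_S(x)-N_S(y)\|\le M\omega(\|x-y\|)$ for all $x,y\in S$. (2) There is $M>0$ such that for every $x\in S$ the set $W_x:=\{p\in X: \langle N_S(x),x-p\rangle\ge M\varphi(2\|x-p\|)\}$ satisfies $W_x\subseteq V$ and $S\cap W_x=\{x\}$. (3) There is $M>0$ with $\langle N_S(y),y-x\rangle\ge \tfrac{\|N_S(x)-N_S(y)\|}{2}\,\omega^{-1}\!\left(\tfrac{\|N_S(x)-N_S(y)\|}{4M}\right)$ for all $x,y\in S$. (4) There exists a convex function $F:X\to\mathbb{R}$ of class $C^{1,\omega}$ such that $S=F^{-1}(1)$ and $\nabla F(x)=N_S(x)$ for all $x\in S$. (5) $S$ is a convex hypersurface of class $C^{1,\omega}$. Furthermore, if $V$ is bounded and $0\in\operatorname{int}(V)$, these are also equivalent to: (6) for every $\alpha>0$, the Minkowski functional $\mu_V$ is of class $C^{1,\omega}$ on $\{x\in X:\mu_V(x)\ge\alpha\}$, i.e. it is differentiable there and there is $K_\alpha>0$ with $\|\nabla\mu_V(x)-\nabla\mu_V(y)\|\le K_\alpha\,\omega(\|x-y\|)$ for all $x,y$ in that set.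
   Context: A convex body is a closed convex set with nonempty interior (possibly unbounded). A modulus of continuity is a concave, strictly increasing function $\omega:[0,\infty)\to[0,\infty)$ with $\omega(0)=0$ and $\lim_{t\to\infty}\omega(t)=\infty$; $\omega^{-1}$ denotes its inverse. A function $F:X\to\mathbb{R}$ on a Banach space is of class $C^{1,\omega}$ if it is Fréchet differentiable and there is $K>0$ with $\|DF(x)-DF(y)\|_*\le K\omega(\|x-y\|)$ for all $x,y$. A subset $S$ of a Banach space $X$ is a convex hypersurface of class $C^{1,\omega}$ if there exist $M>0$ and a convex function $F\in C^{1,\omega}(X)$ with $S=F^{-1}(1)$ and $M^{-1}\le\|DF(x)\|_*\le M$ for all $x\in S$. For $0\in\operatorname{int}(V)$, $\mu_V(x)=\inf\{t>0:x/t\in V\}$. *)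

(* Defs.v *)
From Stdlib Require Import Reals Lra ClassicalEpsilon.
Open Scope R_scope.

Record HilbertSpace := {
  hs_car :> Type;
  hs_zero : hs_car;
  hs_add : hs_car -> hs_car -> hs_car;
  hs_opp : hs_car -> hs_car;
  hs_scal : R -> hs_car -> hs_car;
  hs_inner : hs_car -> hs_car -> R;
  hs_add_assoc : forall x y z, hs_add x (hs_add y z) = hs_add (hs_add x y) z;
  hs_add_comm : forall x y, hs_add x y = hs_add y x;
  hs_add_0 : forall x, hs_add x hs_zero = x;
  hs_add_opp : forall x, hs_add x (hs_opp x) = hs_zero;
  hs_scal_1 : forall x, hs_scal 1 x = x;
  hs_scal_assoc : forall a b x, hs_scal a (hs_scal b x) = hs_scal (a * b) x;
  hs_scal_distr_v : forall a x y, hs_scal a (hs_add x y) = hs_add (hs_scal a x) (hs_scal a y);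
  hs_scal_distr_r : forall a b x, hs_scal (a + b) x = hs_add (hs_scal a x) (hs_scal b x);
  hs_inner_sym : forall x y, hs_inner x y = hs_inner y x;
  hs_inner_add_l : forall x y z, hs_inner (hs_add x y) z = hs_inner x z + hs_inner y z;
  hs_inner_scal_l : forall a x y, hs_inner (hs_scal a x) y = a * hs_inner x y;
  hs_inner_pos : forall x, 0 <= hs_inner x x;
  hs_inner_def : forall x, hs_inner x x = 0 -> x = hs_zero;
  hs_complete : forall u : nat -> hs_car,
    (forall eps, 0 < eps -> exists N, forall m n, (N <= m)%nat -> (N <= n)%nat ->
       sqrt (hs_inner (hs_add (u m) (hs_opp (u n))) (hs_add (u m) (hs_opp (u n)))) < eps) ->
    exists l, forall eps, 0 < eps -> exists N, forall n, (N <= n)%nat ->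
       sqrt (hs_inner (hs_add (u n) (hs_opp l)) (hs_add (u n) (hs_opp l))) < eps
}.

Arguments hs_zero {h}.
Arguments hs_add {h}.
Arguments hs_opp {h}.
Arguments hs_scal {h}.
Arguments hs_inner {h}.

Section HilbertDefs.
Context {X : HilbertSpace}.

Definition vsub (x y : X) : X := hs_add x (hs_opp y).
Definition hnorm (x : X) : R := sqrt (hs_inner x x).
Definition hball (c : X) (r : R) (z : X) : Prop := hnorm (vsub z c) < r.

Definition hinterior (V : X -> Prop) (x : X) : Prop :=
  exists r, 0 < r /\ forall z, hball x r z -> V z.
Definition hclosure (V : X -> Prop) (x : X) : Prop :=
  forall r, 0 < r -> exists z, V z /\ hball x r z.
Definition hboundary (V : X -> Prop) (x : X) : Prop :=
  hclosure V x /\ ~ hinterior V x.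
Definition hclosed_set (V : X -> Prop) : Prop := forall x, hclosure V x -> V x.
Definition hconvex_set (V : X -> Prop) : Prop :=
  forall x y l, V x -> V y -> 0 <= l <= 1 -> V (hs_add (hs_scal l x) (hs_scal (1 - l) y)).
Definition hconvex_body (V : X -> Prop) : Prop :=
  hclosed_set V /\ hconvex_set V /\ exists x, hinterior V x.
Definition hbounded_set (V : X -> Prop) : Prop :=
  exists B, forall x, V x -> hnorm x <= B.

Definition convex_fun (F : X -> R) : Prop :=
  forall x y l, 0 <= l <= 1 ->
    F (hs_add (hs_scal l x) (hs_scal (1 - l) y)) <= l * F x + (1 - l) * F y.

Definition has_gradient (f : X -> R) (x g : X) : Prop :=
  forall eps, 0 < eps -> exists delta, 0 < delta /\
    forall h, hnorm h < delta ->
      Rabs (f (hs_add x h) - f x - hs_inner g h) <= eps * hnorm h.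

Definition C1_hypersurface (S : X -> Prop) : Prop :=
  forall x, S x -> exists r, 0 < r /\ exists (g : X -> R) (G : X -> X),
    (forall z, hball x r z -> has_gradient g z (G z) /\ G z <> hs_zero) /\
    (forall z, hball x r z -> forall eps, 0 < eps -> exists delta, 0 < delta /\
        forall w, hball x r w -> hnorm (vsub w z) < delta -> hnorm (vsub (G w) (G z)) < eps) /\
    (forall z, hball x r z -> (S z <-> g z = 0)).

Definition outer_unit_normal (V : X -> Prop) (x n : X) : Prop :=
  hnorm n = 1 /\ forall y, V y -> hs_inner n (vsub y x) <= 0.

End HilbertDefs.

(** Modulus of continuity. The surjectivity onto [0,oo) clause makes explicit that
    omega : [0,oo) -> [0,oo) is invertible, as the paper uses omega^{-1} on [0,oo). *)
Definition modulus (w : R -> R) : Prop :=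
  (forall s t l, 0 <= s -> 0 <= t -> 0 <= l <= 1 ->
     l * w s + (1 - l) * w t <= w (l * s + (1 - l) * t)) /\
  (forall s t, 0 <= s -> s < t -> w s < w t) /\
  w 0 = 0 /\
  (forall B, exists t, 0 <= t /\ B < w t) /\
  (forall s, 0 <= s -> exists t, 0 <= t /\ w t = s).

Definition omega_inv (w : R -> R) (s : R) : R :=
  epsilon (inhabits 0) (fun t => 0 <= t /\ w t = s).

Section MoreDefs.
Context {X : HilbertSpace}.

Definition C1omega (w : R -> R) (F : X -> R) : Prop :=
  exists (G : X -> X) K, 0 < K /\ (forall x, has_gradient F x (G x)) /\
    forall x y, hnorm (vsub (G x) (G y)) <= K * w (hnorm (vsub x y)).

(** convex hypersurface of class C^{1,omega}; ||DF(x)||_* = ||grad F(x)|| in a Hilbert space *)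
Definition convex_hypersurface_C1omega (w : R -> R) (S : X -> Prop) : Prop :=
  exists M, 0 < M /\ exists F : X -> R, convex_fun F /\ C1omega w F /\
    (forall x, S x <-> F x = 1) /\
    (forall x g, S x -> has_gradient F x g -> / M <= hnorm g <= M).

Definition is_inf (E : R -> Prop) (m : R) : Prop :=
  (forall t, E t -> m <= t) /\ (forall b, (forall t, E t -> b <= t) -> b <= m).

Definition minkowski (V : X -> Prop) (x : X) : R :=
  epsilon (inhabits 0) (is_inf (fun t => 0 < t /\ V (hs_scal (/ t) x))).

End MoreDefs.

(* Main.v *)
(** The implications (1) -> (2) -> (3) -> (1) are elementary; (3) follows from (2) by testing the
interior body at [x] with one of its points in the direction [N y - N x].

By (3) the data (value 1, gradient [N y]) on the boundary satisfy the convex C^{1,omega} extension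
condition: every tangent [1 + <N z, x - z>] lies below every [1 + <N y, x - y> + M phi(|x - y|)].
The function of (4) is the largest convex function [F] below all of the latter. Its second
differences [F(x + h) + F(x - h) - 2 F(x)] inherit the bound [C |h| omega(|h|)] of the upper
functions, because the average [(F(. + h) + F(. - h) - C |h| omega(|h|)) / 2] is again convex and
below them; such a bound forces a convex function to be C^{1,omega}. If [N] is not constant, every
interior point lies on a chord of the boundary, so [F < 1] there; if [N] is constant, [V] is a
half-space and [F] is affine.

For (5) -> (1), a defining function with nonzero gradient has its gradient parallel to the normal,
with the same sign at all boundary points. For (6), the gradient of the gauge at [x] is [N y / <N
y, y>] with [y] the radial projection of [x] to the boundary. *)

Require Import Defs.
From Stdlib Require Import Reals Lra ClassicalEpsilon.
Open Scope R_scope.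

Declare Scope hilbert_scope.
Local Open Scope hilbert_scope.
Local Notation "x ⊕ y" := (hs_add x y) (at level 50, left associativity) : hilbert_scope.
Local Notation "x ⊖ y" := (vsub x y) (at level 50, left associativity) : hilbert_scope.
Local Notation "a ⊙ x" := (hs_scal a x) (at level 40, left associativity) : hilbert_scope.
Local Notation "⟨ x , y ⟩" := (hs_inner x y) (at level 0, format "⟨ x ,  y ⟩") : hilbert_scope.
Local Notation "‖( x )‖" := (hnorm x) (at level 0, format "‖( x )‖") : hilbert_scope.

(** The supremum of the tangents is convex but may have kinks off the boundary; the infimum of the
    upper functions has the second-difference bound but need not be convex. The largest convex
    minorant combines both properties. The Hilbert structure enters the bound for the upper
    functions: by the parallelogram identity |x + h| + |x - h| - 2|x| is at most |h|^2 / |x|, and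
    concavity of omega trades |h|^2 omega(|x|) / |x| for |h| omega(|h|) when |x| > |h|. In (1) ->
    (2) the danger is a segment from x to a point of W_x that leaves V at once. Smoothness of S
    excludes this: every direction at an obtuse angle to the normal enters V. In (4), tangents give
    F > 1 outside V directly, whereas F < 1 inside needs two different normals; hence the case
    distinction. In (5), convexity of F does not fix its orientation: for a half-space F may
    decrease outward, so a global sign has to be carried along. Constants are not optimized; each
    implication may enlarge M. *)

Lemma Rabs_le_inv a b : Rabs a <= b -> - b <= a <= b.
Proof. unfold Rabs. destruct Rcase_abs; lra. Qed.

(** * Hilbert space *)

Section Hilbert.
Context {X : HilbertSpace}.
Implicit Types x y z v : X.

Lemma inner_zero_l x : ⟨hs_zero, x⟩ = 0.
Proof.
  assert (H := hs_inner_add_l X hs_zero hs_zero x).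
  rewrite hs_add_0 in H. lra.
Qed.

Lemma inner_opp_l x y : ⟨hs_opp x, y⟩ = - ⟨x, y⟩.
Proof.
  assert (H := hs_inner_add_l X x (hs_opp x) y).
  rewrite hs_add_opp, inner_zero_l in H. lra.
Qed.

Lemma inner_sub_l x y z : ⟨x ⊖ y, z⟩ = ⟨x, z⟩ - ⟨y, z⟩.
Proof. unfold vsub. rewrite hs_inner_add_l, inner_opp_l. ring. Qed.

Lemma inner_zero_r x : ⟨x, hs_zero⟩ = 0.
Proof. now rewrite hs_inner_sym, inner_zero_l. Qed.

Lemma inner_add_r x y z : ⟨z, x ⊕ y⟩ = ⟨z, x⟩ + ⟨z, y⟩.
Proof. now rewrite hs_inner_sym, hs_inner_add_l, !(hs_inner_sym _ z). Qed.

Lemma inner_opp_r x y : ⟨x, hs_opp y⟩ = - ⟨x, y⟩.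
Proof. now rewrite hs_inner_sym, inner_opp_l, hs_inner_sym. Qed.

Lemma inner_sub_r x y z : ⟨z, x ⊖ y⟩ = ⟨z, x⟩ - ⟨z, y⟩.
Proof. now rewrite hs_inner_sym, inner_sub_l, !(hs_inner_sym _ z). Qed.

Lemma inner_scal_r a x y : ⟨x, a ⊙ y⟩ = a * ⟨x, y⟩.
Proof. now rewrite hs_inner_sym, hs_inner_scal_l, hs_inner_sym. Qed.

End Hilbert.

Ltac inner_expand :=
  rewrite ?hs_inner_add_l, ?inner_sub_l, ?inner_opp_l, ?hs_inner_scal_l, ?inner_zero_l;
  repeat progress rewrite ?hs_inner_add_l, ?inner_sub_l, ?inner_opp_l, ?hs_inner_scal_l,
    ?inner_zero_l, ?inner_add_r, ?inner_sub_r, ?inner_opp_r, ?inner_scal_r, ?inner_zero_r.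

Lemma vec_ext {X : HilbertSpace} (x y : X) : (forall z, ⟨x, z⟩ = ⟨y, z⟩) -> x = y.
Proof.
  intros H.
  assert (E : x ⊖ y = hs_zero).
  { apply hs_inner_def. rewrite inner_sub_l, H. ring. }
  assert (E' : x = (x ⊖ y) ⊕ y).
  { unfold vsub. rewrite <- hs_add_assoc, (hs_add_comm _ (hs_opp y)), hs_add_opp.
    now rewrite hs_add_0. }
  rewrite E', E, hs_add_comm. apply hs_add_0.
Qed.

(* Vector identities are tested against an arbitrary vector, where they become identities in R. *)
Ltac vec := apply vec_ext; intro; inner_expand; try ring; try field.

Section Norm.
Context {X : HilbertSpace}.
Implicit Types x y z v : X.

Lemma norm_nonneg x : 0 <= ‖(x)‖.
Proof. apply sqrt_pos. Qed.

Lemma norm_sq x : ‖(x)‖ * ‖(x)‖ = ⟨x, x⟩.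
Proof. apply sqrt_sqrt, hs_inner_pos. Qed.

Lemma norm_zero : ‖(@hs_zero X)‖ = 0.
Proof. unfold hnorm. rewrite inner_zero_l. apply sqrt_0. Qed.

Lemma norm_eq0 x : ‖(x)‖ = 0 -> x = hs_zero.
Proof. intros H. apply hs_inner_def. rewrite <- norm_sq, H. ring. Qed.

Lemma norm_pos x : x <> hs_zero -> 0 < ‖(x)‖.
Proof.
  intros H. destruct (norm_nonneg x) as [|E]; [easy|].
  now destruct H; apply norm_eq0.
Qed.

Lemma norm_le_of_sq x c : 0 <= c -> ⟨x, x⟩ <= c * c -> ‖(x)‖ <= c.
Proof. intros Hc H. rewrite <- norm_sq in H. assert (H' := norm_nonneg x). nra. Qed.

Lemma norm_scal a x : ‖(a ⊙ x)‖ = Rabs a * ‖(x)‖.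
Proof.
  unfold hnorm. inner_expand.
  rewrite <- Rmult_assoc, sqrt_mult by (try apply hs_inner_pos; nra).
  now rewrite <- sqrt_Rsqr_abs.
Qed.

Lemma norm_scal_pos a x : 0 <= a -> ‖(a ⊙ x)‖ = a * ‖(x)‖.
Proof. intros H. now rewrite norm_scal, Rabs_pos_eq. Qed.

Lemma norm_sub_sym x y : ‖(x ⊖ y)‖ = ‖(y ⊖ x)‖.
Proof. unfold hnorm. f_equal. inner_expand. ring. Qed.

Lemma cauchy_schwarz x y : ⟨x, y⟩ <= ‖(x)‖ * ‖(y)‖.
Proof.
  assert (Hx := norm_nonneg x). assert (Hy := norm_nonneg y).
  destruct Hx as [Hx|Hx].
  2:{ rewrite (norm_eq0 x), inner_zero_l, norm_zero by easy. lra. }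
  destruct Hy as [Hy|Hy].
  2:{ rewrite (norm_eq0 y), inner_zero_r, norm_zero by easy. lra. }
  assert (H := hs_inner_pos X (‖(y)‖ ⊙ x ⊖ ‖(x)‖ ⊙ y)).
  revert H. inner_expand. rewrite (hs_inner_sym _ y x), <- !norm_sq. intros H.
  assert (0 < ‖(x)‖ * ‖(y)‖) by nra.
  nra.
Qed.

Lemma cauchy_schwarz_abs x y : Rabs ⟨x, y⟩ <= ‖(x)‖ * ‖(y)‖.
Proof.
  apply Rabs_le. split; [|apply cauchy_schwarz].
  assert (H := cauchy_schwarz (hs_opp x) y).
  assert (E : ‖(hs_opp x)‖ = ‖(x)‖) by (unfold hnorm; f_equal; inner_expand; ring).
  rewrite E, inner_opp_l in H. lra.
Qed.

Lemma norm_triangle x y : ‖(x ⊕ y)‖ <= ‖(x)‖ + ‖(y)‖.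
Proof.
  assert (Hx := norm_nonneg x). assert (Hy := norm_nonneg y).
  apply norm_le_of_sq; [lra|].
  inner_expand. rewrite (hs_inner_sym _ y x), <- !norm_sq.
  assert (H := cauchy_schwarz x y). nra.
Qed.

Lemma norm_sub_triangle x y : ‖(x ⊖ y)‖ <= ‖(x)‖ + ‖(y)‖.
Proof.
  replace (x ⊖ y) with (x ⊕ (-1) ⊙ y) by vec.
  eapply Rle_trans; [apply norm_triangle|].
  rewrite norm_scal, Rabs_left by lra. lra.
Qed.

Lemma norm_rev_triangle x y : Rabs (‖(x)‖ - ‖(y)‖) <= ‖(x ⊖ y)‖.
Proof.
  assert (H1 := norm_triangle (x ⊖ y) y). assert (H2 := norm_triangle (y ⊖ x) x).
  replace (x ⊖ y ⊕ y) with x in H1 by vec.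
  replace (y ⊖ x ⊕ x) with y in H2 by vec.
  rewrite (norm_sub_sym y) in H2. apply Rabs_le. lra.
Qed.

Lemma norm_unit_dist x y : ‖(x)‖ = 1 -> ‖(y)‖ = 1 ->
  ‖(x ⊖ y)‖ * ‖(x ⊖ y)‖ = 2 - 2 * ⟨x, y⟩.
Proof.
  intros Hx Hy. rewrite norm_sq. inner_expand.
  rewrite (hs_inner_sym _ y x), <- !norm_sq, Hx, Hy. ring.
Qed.

(** With 1/|x| factored out, what remains is x - y plus a multiple of the unit vector y/|y| of
    length ||y| - |x||, which is at most |x - y|. *)
Lemma norm_normalize_dist x y : 0 < ‖(x)‖ -> 0 < ‖(y)‖ ->
  ‖(/ ‖(x)‖ ⊙ x ⊖ / ‖(y)‖ ⊙ y)‖ <= 2 * ‖(x ⊖ y)‖ / ‖(x)‖.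
Proof.
  intros Hx Hy.
  replace (/ ‖(x)‖ ⊙ x ⊖ / ‖(y)‖ ⊙ y)
    with (/ ‖(x)‖ ⊙ ((x ⊖ y) ⊕ ((‖(y)‖ - ‖(x)‖) / ‖(y)‖) ⊙ y)) by (vec; lra).
  rewrite norm_scal_pos by (left; now apply Rinv_0_lt_compat).
  replace (2 * ‖(x ⊖ y)‖ / ‖(x)‖) with (/ ‖(x)‖ * (‖(x ⊖ y)‖ + ‖(x ⊖ y)‖)) by (field; lra).
  apply Rmult_le_compat_l; [left; now apply Rinv_0_lt_compat|].
  eapply Rle_trans; [apply norm_triangle|].
  apply Rplus_le_compat_l. unfold Rdiv.
  rewrite norm_scal, Rabs_mult, (Rabs_pos_eq (/ _)) by (left; now apply Rinv_0_lt_compat).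
  rewrite Rmult_assoc, Rinv_l, Rmult_1_r by lra.
  rewrite (norm_sub_sym x). apply norm_rev_triangle.
Qed.

(* Minimizing sequences of [‖(v)‖² / 2 - l v] are Cauchy by the parallelogram identity. *)
Lemma riesz (l : X -> R) (C : R) :
  (forall x y, l (x ⊕ y) = l x + l y) -> (forall a x, l (a ⊙ x) = a * l x) ->
  (forall x, l x <= C * ‖(x)‖) -> exists g, forall x, l x = ⟨g, x⟩.
Proof.
  intros Hadd Hscal HC.
  set (q x := ⟨x, x⟩ / 2 - l x).
  assert (Hbd : forall x, - (C * C) / 2 <= q x).
  { intros x. unfold q. rewrite <- norm_sq. assert (H := HC x).
    assert (H' := Rle_0_sqr (‖(x)‖ - C)). unfold Rsqr in H'. lra. }
  (* Completeness provides suprema, so the infimum of [q] appears as [- m]. *)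
  destruct (completeness (fun t => exists x, t = - q x)) as [m [Hub Hlub]].
  { exists (C * C / 2). intros t [x ->]. specialize (Hbd x). lra. }
  { exists (- q hs_zero). now exists hs_zero. }
  assert (Hm : forall x, - m <= q x).
  { intros x. enough (- q x <= m) by lra. apply Hub. now exists x. }
  assert (Happ : forall n : nat, exists x, q x < - m + / (INR n + 1)).
  { intros n. assert (Hn : 0 < / (INR n + 1)).
    { apply Rinv_0_lt_compat. assert (H := pos_INR n). lra. }
    apply NNPP. intros Hno.
    enough (m <= m - / (INR n + 1)) by lra.
    apply Hlub. intros t [x ->].
    destruct (Rlt_or_le (q x) (- m + / (INR n + 1))); [|lra].
    destruct Hno. now exists x. }
  destruct (choice _ Happ) as [u Hu].
  assert (Hpar : forall x y, ⟨x ⊖ y, x ⊖ y⟩ / 4 <= q x + q y + 2 * m).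
  { intros x y. assert (H := Hm ((1 / 2) ⊙ (x ⊕ y))). revert H. unfold q.
    rewrite Hscal, Hadd. inner_expand. rewrite (hs_inner_sym _ y x). lra. }
  assert (Hsmall : forall eps, 0 < eps -> exists n0, forall n, (n0 <= n)%nat ->
    / (INR n + 1) < eps).
  { intros eps Heps. destruct (archimed_cor1 eps Heps) as [n0 [H1 H2]].
    exists n0. intros n Hn. eapply Rlt_trans; [|apply H1].
    apply lt_INR in H2. apply le_INR in Hn. simpl in H2.
    apply Rinv_lt_contravar; nra. }
  destruct (hs_complete X u) as [g Hg].
  { intros eps Heps. destruct (Hsmall (eps * eps / 8)) as [n0 Hn0]; [nra|].
    exists n0. intros i j Hi Hj.
    change (‖(u i ⊖ u j)‖ < eps).
    assert (H := Hpar (u i) (u j)). rewrite <- norm_sq in H.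
    assert (Hi' := Hn0 i Hi). assert (Hj' := Hn0 j Hj).
    assert (Hi'' := Hu i). assert (Hj'' := Hu j). assert (Hp := norm_nonneg (u i ⊖ u j)).
    nra. }
  exists g. intros v.
  (* First variation of [q] at [u n], in the limit. *)
  assert (Hvar : forall t v, 0 < t -> l v - ⟨g, v⟩ <= t * (⟨v, v⟩ + ‖(v)‖ + 1)).
  { clear v. intros t v Ht.
    destruct (Hg t Ht) as [n1 Hn1]. destruct (Hsmall (t * t)) as [n2 Hn2]; [nra|].
    set (n := Nat.max n1 n2).
    specialize (Hn1 n (Nat.le_max_l _ _)). specialize (Hn2 n (Nat.le_max_r _ _)).
    change (‖(u n ⊖ g)‖ < t) in Hn1.
    assert (Hq := Hu n). assert (Hq' := Hm (u n ⊕ t ⊙ v)).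
    assert (Hcs := cauchy_schwarz (u n ⊖ g) v). revert Hcs. rewrite inner_sub_l. intros Hcs.
    revert Hq Hq'. unfold q. rewrite Hadd, Hscal. inner_expand.
    rewrite (hs_inner_sym _ v (u n)). intros Hq Hq'.
    assert (Hvv := hs_inner_pos X v). assert (Hv := norm_nonneg v).
    assert (H1 : t * (l v - ⟨u n, v⟩) <= t * t * ⟨v, v⟩ / 2 + t * t) by lra.
    assert (H2 : l v - ⟨u n, v⟩ <= t * (⟨v, v⟩ / 2 + 1)).
    { apply Rmult_le_reg_l with t; lra. }
    nra. }
  assert (Hle : forall v, l v <= ⟨g, v⟩).
  { clear v. intros v. apply Rnot_lt_le. intros Hlt.
    assert (Hvv := hs_inner_pos X v). assert (Hv := norm_nonneg v).
    (* This [t] turns the bound of [Hvar] into half of the gap itself. *)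
    assert (H := Hvar ((l v - ⟨g, v⟩) / (2 * (⟨v, v⟩ + ‖(v)‖ + 1))) v).
    replace ((l v - ⟨g, v⟩) / (2 * (⟨v, v⟩ + ‖(v)‖ + 1)) * (⟨v, v⟩ + ‖(v)‖ + 1))
      with ((l v - ⟨g, v⟩) / 2) in H by (field; lra).
    enough (l v - ⟨g, v⟩ <= (l v - ⟨g, v⟩) / 2) by lra.
    apply H. apply Rdiv_lt_0_compat; lra. }
  apply Rle_antisym; [apply Hle|].
  assert (H := Hle ((-1) ⊙ v)). rewrite Hscal, inner_scal_r in H. lra.
Qed.

End Norm.
(** * Gradients and convex functions *)

Section Gradient.
Context {X : HilbertSpace}.
Implicit Types (x y z v g : X) (f F : X -> R).

Lemma gradient_along f x g v : has_gradient f x g ->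
  forall eps, 0 < eps -> exists delta, 0 < delta /\
    forall t, 0 < t < delta -> Rabs (f (x ⊕ t ⊙ v) - f x - t * ⟨g, v⟩) <= eps * t.
Proof.
  intros H eps Heps. assert (Hv := norm_nonneg v).
  destruct (H (eps / (‖(v)‖ + 1))) as [d [Hd Hgrad]].
  { apply Rdiv_lt_0_compat; lra. }
  exists (d / (‖(v)‖ + 1)). split; [apply Rdiv_lt_0_compat; lra|].
  intros t [Ht Htd].
  assert (Htv : t * (‖(v)‖ + 1) < d).
  { apply Rmult_lt_reg_r with (/ (‖(v)‖ + 1)); [apply Rinv_0_lt_compat; lra|].
    rewrite Rmult_assoc, Rinv_r by lra. unfold Rdiv in Htd. lra. }
  specialize (Hgrad (t ⊙ v)). rewrite norm_scal_pos, inner_scal_r in Hgrad by lra.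
  eapply Rle_trans; [apply Hgrad; nra|].
  replace (eps * t) with (eps / (‖(v)‖ + 1) * (t * (‖(v)‖ + 1))) by (field; lra).
  apply Rmult_le_compat_l; [|nra].
  left. apply Rdiv_lt_0_compat; lra.
Qed.

Lemma gradient_unique f x g g' : has_gradient f x g -> has_gradient f x g' -> g = g'.
Proof.
  intros H H'. apply vec_ext. intros v.
  destruct (Req_dec ⟨g, v⟩ ⟨g', v⟩) as [|Hne]; [easy|exfalso].
  set (eps := Rabs (⟨g, v⟩ - ⟨g', v⟩) / 4).
  assert (Heps : 0 < eps).
  { apply Rdiv_lt_0_compat; [|lra]. apply Rabs_pos_lt. lra. }
  destruct (gradient_along f x g v H eps Heps) as [d [Hd Hg]].
  destruct (gradient_along f x g' v H' eps Heps) as [d' [Hd' Hg']].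
  set (t := Rmin d d' / 2).
  assert (Hmin : 0 < Rmin d d') by now apply Rmin_pos.
  assert (Hl := Rmin_l d d'). assert (Hr := Rmin_r d d').
  specialize (Hg t ltac:(unfold t; lra)). specialize (Hg' t ltac:(unfold t; lra)).
  assert (Ht : 0 < t) by (unfold t; lra).
  assert (Habs : t * Rabs (⟨g, v⟩ - ⟨g', v⟩) <= 2 * eps * t).
  { rewrite <- (Rabs_pos_eq t) at 1 by lra. rewrite <- Rabs_mult.
    revert Hg Hg'. unfold Rabs. repeat destruct Rcase_abs; lra. }
  unfold eps in Habs, Heps. nra.
Qed.

Lemma gradient_decrease f x g v : has_gradient f x g -> ⟨g, v⟩ < 0 ->
  exists delta, 0 < delta /\ forall t, 0 < t < delta -> f (x ⊕ t ⊙ v) < f x.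
Proof.
  intros H Hv.
  destruct (gradient_along f x g v H (- ⟨g, v⟩ / 2)) as [d [Hd Hg]]; [lra|].
  exists d. split; [easy|]. intros t Ht. specialize (Hg t Ht).
  apply Rabs_le_inv in Hg. nra.
Qed.

Lemma convex_along F x y t : convex_fun F -> 0 <= t <= 1 ->
  F (x ⊕ t ⊙ (y ⊖ x)) <= (1 - t) * F x + t * F y.
Proof.
  intros HF Ht. replace (x ⊕ t ⊙ (y ⊖ x)) with (t ⊙ y ⊕ (1 - t) ⊙ x) by vec.
  specialize (HF y x t Ht). lra.
Qed.

Lemma convex_above_tangent F x y g : convex_fun F -> has_gradient F x g ->
  F x + ⟨g, y ⊖ x⟩ <= F y.
Proof.
  intros HF Hg. apply Rnot_lt_le. intros Hlt.
  destruct (gradient_along F x g (y ⊖ x) Hg ((F x + ⟨g, y ⊖ x⟩ - F y) / 2))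
    as [d [Hd H]]; [lra|].
  set (t := Rmin d 1 / 2).
  assert (Hmin : 0 < Rmin d 1) by (apply Rmin_pos; lra).
  assert (Hl := Rmin_l d 1). assert (Hr := Rmin_r d 1).
  assert (Ht : 0 < t) by (unfold t; lra).
  specialize (H t ltac:(unfold t; lra)). apply Rabs_le_inv in H.
  assert (Hc := convex_along F x y t HF ltac:(unfold t; lra)). nra.
Qed.

Lemma affine_gradient (c : R) x0 g x :
  has_gradient (fun z => c + ⟨g, z ⊖ x0⟩) x g.
Proof.
  intros eps Heps. exists 1. split; [lra|]. intros h _.
  replace (c + ⟨g, x ⊕ h ⊖ x0⟩ - (c + ⟨g, x ⊖ x0⟩) - ⟨g, h⟩) with 0 by (inner_expand; ring).
  rewrite Rabs_R0. assert (H := norm_nonneg h). nra.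
Qed.

Lemma affine_convex (c : R) x0 g : convex_fun (fun z => c + ⟨g, z ⊖ x0⟩).
Proof. intros x y t Ht. right. inner_expand. ring. Qed.

End Gradient.

(** * Moduli of continuity *)

Section Modulus.
Context {w : R -> R} (Hw : modulus w).

Lemma modulus_nonneg t : 0 <= t -> 0 <= w t.
Proof.
  destruct Hw as (_ & Hinc & H0 & _). intros [Ht| <-].
  - specialize (Hinc 0 t). lra.
  - lra.
Qed.

Lemma modulus_pos t : 0 < t -> 0 < w t.
Proof. destruct Hw as (_ & Hinc & H0 & _). intros Ht. specialize (Hinc 0 t). lra. Qed.

Lemma modulus_mono s t : 0 <= s -> s <= t -> w s <= w t.
Proof.
  destruct Hw as (_ & Hinc & _). intros Hs [Hst| ->]; [|lra].
  left. now apply Hinc.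
Qed.

Lemma modulus_scale_ge l t : 0 <= l <= 1 -> 0 <= t -> l * w t <= w (l * t).
Proof.
  destruct Hw as (Hconc & _ & H0 & _). intros Hl Ht.
  specialize (Hconc t 0 l Ht (Rle_refl 0) Hl). rewrite H0 in Hconc.
  replace (l * t + (1 - l) * 0) with (l * t) in Hconc by ring. lra.
Qed.

Lemma modulus_scale_le c t : 1 <= c -> 0 <= t -> w (c * t) <= c * w t.
Proof.
  intros Hc Ht.
  assert (H := modulus_scale_ge (/ c) (c * t)).
  rewrite <- Rmult_assoc, Rinv_l, Rmult_1_l in H by lra.
  assert (Hi : 0 < / c) by (apply Rinv_0_lt_compat; lra).
  assert (Hi1 : / c <= 1) by (rewrite <- Rinv_1; apply Rinv_le_contravar; lra).
  apply Rmult_le_reg_l with (/ c); [easy|].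
  rewrite <- Rmult_assoc, Rinv_l, Rmult_1_l by lra. apply H; nra.
Qed.

(** Both s and t are fractions of s + t, and concavity with [w 0 = 0] gives each at least its share
    of [w (s + t)]. *)
Lemma modulus_subadditive s t : 0 <= s -> 0 <= t -> w (s + t) <= w s + w t.
Proof.
  intros Hs Ht. destruct (Req_dec (s + t) 0) as [E|E].
  { replace s with 0 by lra. replace t with 0 by lra. rewrite Rplus_0_l.
    assert (H := modulus_nonneg 0). lra. }
  assert (Hfrac : forall a, 0 <= a <= s + t -> a / (s + t) * w (s + t) <= w a).
  { intros a Ha. replace a with (a / (s + t) * (s + t)) at 2 by (field; lra).
    apply modulus_scale_ge; [|lra]. split.
    - apply Rmult_le_pos; [lra|]. left. apply Rinv_0_lt_compat. lra.
    - apply Rmult_le_reg_r with (s + t); [lra|].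
      unfold Rdiv. rewrite Rmult_assoc, Rinv_l by lra. lra. }
  assert (H1 := Hfrac s ltac:(lra)). assert (H2 := Hfrac t ltac:(lra)).
  replace (w (s + t)) with (s / (s + t) * w (s + t) + t / (s + t) * w (s + t)) by (field; lra).
  lra.
Qed.

(* Concavity makes [w s / s] nonincreasing. *)
Lemma modulus_linear_le s b : 0 <= s <= b -> 0 < b -> s * w b <= b * w s.
Proof.
  intros Hs Hb. assert (H := modulus_scale_ge (s / b) b).
  replace (s / b * b) with s in H by (field; lra).
  assert (Hsb : 0 <= s / b <= 1).
  { split.
    - apply Rmult_le_pos; [lra|]. left. now apply Rinv_0_lt_compat.
    - apply Rmult_le_reg_r with b; [easy|]. unfold Rdiv. rewrite Rmult_assoc, Rinv_l by lra. lra. }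
  specialize (H Hsb ltac:(lra)).
  apply Rmult_le_compat_l with (r := b) in H; [|lra].
  replace (b * (s / b * w b)) with (s * w b) in H by (field; lra). easy.
Qed.

(** Continuity at zero comes from surjectivity: a preimage of [eps] serves as [delta]. *)
Lemma modulus_small eps : 0 < eps -> exists delta, 0 < delta /\
  forall t, 0 <= t <= delta -> w t <= eps.
Proof.
  destruct Hw as (_ & _ & H0 & _ & Hsurj). intros Heps.
  destruct (Hsurj eps) as [d [Hd Hwd]]; [lra|].
  exists d. split.
  - destruct Hd as [|<-]; [easy|lra].
  - intros t Ht. rewrite <- Hwd. apply modulus_mono; lra.
Qed.

Lemma omega_inv_spec s : 0 <= s -> 0 <= omega_inv w s /\ w (omega_inv w s) = s.
Proof.
  destruct Hw as (_ & _ & _ & _ & Hsurj). intros Hs.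
  exact (epsilon_spec (inhabits 0) (fun t => 0 <= t /\ w t = s) (Hsurj s Hs)).
Qed.

(* For [t < a] this bounds the integral from above, for [t > a] from below. *)
Lemma integral_tangent (phi : R -> R)
  (Hphi : forall t, 0 <= t -> exists pr : Riemann_integrable w 0 t, RiemannInt pr = phi t)
  a t : 0 <= a -> 0 <= t -> w a * (t - a) <= phi t - phi a.
Proof.
  intros Ha Ht. destruct (Hphi a Ha) as [pa <-]. destruct (Hphi t Ht) as [pt <-].
  destruct (Rle_or_lt a t) as [Hat|Hta].
  - assert (p := RiemannInt_P23 (a:=0) (c:=a) pt ltac:(lra)).
    rewrite <- (RiemannInt_P26 pa p pt).
    rewrite <- (RiemannInt_P15 (RiemannInt_P14 a t (w a))).
    enough (RiemannInt (RiemannInt_P14 a t (w a)) <= RiemannInt p) by lra.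
    apply RiemannInt_P19; [easy|]. intros s Hs. apply modulus_mono; lra.
  - assert (p := RiemannInt_P23 (a:=0) (c:=t) pa ltac:(lra)).
    rewrite <- (RiemannInt_P26 pt p pa).
    replace (w a * (t - a)) with (- (w a * (a - t))) by ring.
    rewrite <- (RiemannInt_P15 (RiemannInt_P14 t a (w a))).
    enough (RiemannInt p <= RiemannInt (RiemannInt_P14 t a (w a))) by lra.
    apply RiemannInt_P19; [lra|]. intros s Hs. apply modulus_mono; lra.
Qed.

Lemma integral_zero (phi : R -> R)
  (Hphi : forall t, 0 <= t -> exists pr : Riemann_integrable w 0 t, RiemannInt pr = phi t) :
  phi 0 = 0.
Proof. destruct (Hphi 0 (Rle_refl 0)) as [pr <-]. apply RiemannInt_P9. Qed.

End Modulus.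

(** * Convex bodies and their normals *)

Section ConvexBody.
Context {X : HilbertSpace} {V : X -> Prop} (HV : hconvex_body V).
Implicit Types (x y z p v n a : X).

Lemma closure_in x : V x -> hclosure V x.
Proof.
  intros Hx r Hr. exists x. split; [easy|].
  unfold hball. replace (x ⊖ x) with (@hs_zero X) by vec. now rewrite norm_zero.
Qed.

Lemma interior_in x : hinterior V x -> V x.
Proof.
  intros [r [Hr H]]. apply H.
  unfold hball. replace (x ⊖ x) with (@hs_zero X) by vec. now rewrite norm_zero.
Qed.

Lemma boundary_in x : hboundary V x -> V x.
Proof. intros [H _]. now apply (proj1 HV). Qed.

Lemma convex_body_along x y t : V x -> V y -> 0 <= t <= 1 -> V (x ⊕ t ⊙ (y ⊖ x)).
Proof.
  intros Hx Hy Ht. replace (x ⊕ t ⊙ (y ⊖ x)) with (t ⊙ y ⊕ (1 - t) ⊙ x) by vec.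
  now apply (proj1 (proj2 HV)).
Qed.

(** The crossing is the last parameter [m] at which the segment is still in V: closedness keeps that
    point in V and away from p, and an interior point would allow a larger parameter. If z itself is
    a boundary point, u = 0 may occur. *)
Lemma boundary_crossing z p : V z -> ~ V p ->
  exists u, 0 <= u < 1 /\ hboundary V (z ⊕ u ⊙ (p ⊖ z)).
Proof.
  intros Hz Hp. set (q u := z ⊕ u ⊙ (p ⊖ z)).
  assert (Hn := norm_nonneg (p ⊖ z)).
  assert (Hdist : forall u u', ‖(q u ⊖ q u')‖ = Rabs (u - u') * ‖(p ⊖ z)‖).
  { intros u u'. rewrite <- norm_scal. f_equal. unfold q. vec. }
  destruct (completeness (fun u => 0 <= u <= 1 /\ V (q u))) as [m [Hub Hlub]].
  { exists 1. intros u [Hu _]. lra. }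
  { exists 0. split; [lra|]. unfold q. now replace (z ⊕ 0 ⊙ (p ⊖ z)) with z by vec. }
  assert (Hm0 : 0 <= m).
  { apply Hub. split; [lra|]. unfold q. now replace (z ⊕ 0 ⊙ (p ⊖ z)) with z by vec. }
  assert (Hm1 : m <= 1) by (apply Hlub; intros u [Hu _]; lra).
  assert (Hcl : hclosure V (q m)).
  { intros r Hr. assert (He : 0 < r / (‖(p ⊖ z)‖ + 1)) by (apply Rdiv_lt_0_compat; lra).
    assert (Hex : exists u, (0 <= u <= 1 /\ V (q u)) /\ m - r / (‖(p ⊖ z)‖ + 1) < u).
    { apply NNPP. intros Hno. enough (m <= m - r / (‖(p ⊖ z)‖ + 1)) by lra.
      apply Hlub. intros u Hu. apply Rnot_lt_le. intros Hlt. apply Hno. now exists u. }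
    destruct Hex as [u [[Hu HVu] Hlt]]. exists (q u). split; [easy|].
    unfold hball. rewrite Hdist.
    assert (Hum : u <= m) by now apply Hub.
    rewrite Rabs_left1 by lra.
    apply Rle_lt_trans with (r / (‖(p ⊖ z)‖ + 1) * ‖(p ⊖ z)‖).
    { apply Rmult_le_compat_r; lra. }
    replace r with (r / (‖(p ⊖ z)‖ + 1) * (‖(p ⊖ z)‖ + 1)) at 2 by (field; lra).
    apply Rmult_lt_compat_l; lra. }
  assert (Hmlt : m < 1).
  { destruct Hm1 as [|E]; [easy|]. exfalso. apply Hp, (proj1 HV).
    replace p with (q m); [easy|]. rewrite E. unfold q. vec. }
  exists m. split; [easy|]. split; [exact Hcl|].
  intros [r [Hr Hball]].
  assert (He : 0 < r / (‖(p ⊖ z)‖ + 1)) by (apply Rdiv_lt_0_compat; lra).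
  set (d := Rmin (1 - m) (r / (‖(p ⊖ z)‖ + 1))).
  assert (Hd : 0 < d) by (apply Rmin_pos; lra).
  assert (Hd1 : d <= 1 - m) by apply Rmin_l.
  assert (Hd2 : d <= r / (‖(p ⊖ z)‖ + 1)) by apply Rmin_r.
  enough (m + d <= m) by lra.
  apply Hub. split; [lra|]. apply Hball. unfold hball.
  change (‖(q (m + d) ⊖ q m)‖ < r). rewrite Hdist.
  replace (m + d - m) with d by ring. rewrite Rabs_pos_eq by lra.
  apply Rle_lt_trans with (r / (‖(p ⊖ z)‖ + 1) * ‖(p ⊖ z)‖).
  { apply Rmult_le_compat_r; lra. }
  replace r with (r / (‖(p ⊖ z)‖ + 1) * (‖(p ⊖ z)‖ + 1)) at 2 by (field; lra).
  apply Rmult_lt_compat_l; lra.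
Qed.

(** The homothety with centre x and ratio t maps V into V and a ball of radius r about z onto one of
    radius t r. *)
Lemma interior_segment x z t : V x -> hinterior V z -> 0 < t <= 1 ->
  hinterior V (x ⊕ t ⊙ (z ⊖ x)).
Proof.
  intros Hx [r [Hr Hball]] Ht. exists (t * r). split; [nra|].
  intros y Hy. unfold hball in Hy.
  set (z' := z ⊕ / t ⊙ (y ⊖ (x ⊕ t ⊙ (z ⊖ x)))).
  replace y with (x ⊕ t ⊙ (z' ⊖ x)) by (unfold z'; vec; lra).
  apply convex_body_along; [easy| |lra].
  apply Hball. unfold hball.
  replace (z' ⊖ z) with (/ t ⊙ (y ⊖ (x ⊕ t ⊙ (z ⊖ x)))) by (unfold z'; vec).
  rewrite norm_scal_pos by (left; apply Rinv_0_lt_compat; lra).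
  apply Rmult_lt_reg_l with t; [lra|].
  rewrite <- Rmult_assoc, Rinv_r, Rmult_1_l by lra. easy.
Qed.

Lemma interior_shift z v : hinterior V z -> exists e, 0 < e /\ V (z ⊕ e ⊙ v).
Proof.
  intros [r [Hr Hball]]. assert (Hv := norm_nonneg v).
  exists (r / (‖(v)‖ + 1)). assert (He : 0 < r / (‖(v)‖ + 1)) by (apply Rdiv_lt_0_compat; lra).
  split; [easy|].
  apply Hball. unfold hball.
  replace (z ⊕ (r / (‖(v)‖ + 1)) ⊙ v ⊖ z) with ((r / (‖(v)‖ + 1)) ⊙ v) by vec.
  rewrite norm_scal_pos by lra.
  replace r with (r / (‖(v)‖ + 1) * (‖(v)‖ + 1)) at 2 by (field; lra).
  apply Rmult_lt_compat_l; lra.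
Qed.

Lemma normal_unit x n : outer_unit_normal V x n -> ⟨n, n⟩ = 1.
Proof. intros [H _]. rewrite <- norm_sq, H. ring. Qed.

Lemma normal_interior x z n : outer_unit_normal V x n -> hinterior V z -> ⟨n, z ⊖ x⟩ < 0.
Proof.
  intros Hn Hz. destruct (interior_shift z n Hz) as [e [He HVe]].
  assert (H := proj2 Hn _ HVe). revert H. inner_expand.
  rewrite (normal_unit x n Hn). lra.
Qed.

(** At a crossing point y between an interior point z and p, the normal is negative on z - y, hence
    positive on the opposite direction p - y. *)
Lemma exists_separating_normal (N : X -> X) p :
  (forall x, hboundary V x -> outer_unit_normal V x (N x)) -> ~ V p ->
  exists y, hboundary V y /\ 0 < ⟨N y, p ⊖ y⟩.
Proof.
  intros HN Hp. destruct (proj2 (proj2 HV)) as [z Hz].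
  destruct (boundary_crossing z p (interior_in z Hz) Hp) as [u [Hu Hy]].
  exists (z ⊕ u ⊙ (p ⊖ z)). split; [easy|].
  assert (H := normal_interior _ z _ (HN _ Hy) Hz).
  revert H. generalize (N (z ⊕ u ⊙ (p ⊖ z))). intros n. inner_expand.
  intros H. assert (H' : 0 < u * (⟨n, p⟩ - ⟨n, z⟩)) by lra.
  assert (0 < ⟨n, p⟩ - ⟨n, z⟩) by nra. nra.
Qed.

(* If the direction [v] leaves [V] and [z ⊖ x] enters it, the boundary has points close to [x] in
   directions between the two, where [f] varies to first order by [⟨a, _⟩]. *)
Lemma gradient_opposite_sign (f : X -> R) x a v z r d :
  hboundary V x -> has_gradient f x a -> 0 < r ->
  (forall y, hball x r y -> hboundary V y -> f y = f x) ->
  V z -> 0 < d -> (forall t, 0 < t < d -> ~ V (x ⊕ t ⊙ v)) ->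
  ⟨a, v⟩ * ⟨a, z ⊖ x⟩ <= 0.
Proof.
  intros Hx Hf Hr Hconst Hz Hd Hout. apply Rnot_lt_le. intros Hpos.
  set (A := ⟨a, v⟩) in *. set (B := ⟨a, z ⊖ x⟩) in *.
  set (C := ‖(v)‖ + ‖(z ⊖ x)‖ + 1).
  assert (Hv := norm_nonneg v). assert (Hzx := norm_nonneg (z ⊖ x)).
  (* If A and B have the same sign, every convex combination of them has absolute value at least
     [m]; the expansion of [f] at a nearby boundary point will bound one such combination by
     [m / 2]. *)
  set (m := Rmin (Rabs A) (Rabs B)).
  assert (Hm : 0 < m).
  { apply Rmin_pos; apply Rabs_pos_lt; intros E; rewrite E in Hpos; lra. }
  assert (HmA : m <= Rabs A) by apply Rmin_l. assert (HmB : m <= Rabs B) by apply Rmin_r.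
  destruct (Hf (m / (2 * C))) as [d' [Hd' Hgrad]].
  { apply Rdiv_lt_0_compat; unfold C; lra. }
  set (e := Rmin r d').
  assert (He : 0 < e) by now apply Rmin_pos.
  assert (Her : e <= r) by apply Rmin_l. assert (Hed : e <= d') by apply Rmin_r.
  set (t := Rmin (Rmin d 1 / 2) (e / (2 * C))).
  assert (Hec : 0 < e / (2 * C)) by (apply Rdiv_lt_0_compat; unfold C; lra).
  assert (Hd1 : 0 < Rmin d 1) by (apply Rmin_pos; lra).
  assert (Hd1l := Rmin_l d 1). assert (Hd1r := Rmin_r d 1).
  assert (Ht : 0 < t) by (apply Rmin_pos; lra).
  assert (Ht1 : t <= Rmin d 1 / 2) by apply Rmin_l.
  assert (Ht2 : t <= e / (2 * C)) by apply Rmin_r.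
  assert (HtC : t * C < e).
  { apply Rle_lt_trans with (e / (2 * C) * C).
    - apply Rmult_le_compat_r; [unfold C; lra|easy].
    - replace (e / (2 * C) * C) with (e / 2) by (field; unfold C; lra). lra. }
  destruct (boundary_crossing (x ⊕ t ⊙ (z ⊖ x)) (x ⊕ t ⊙ v)) as [u [Hu Hy]].
  { apply convex_body_along; [now apply boundary_in|easy|lra]. }
  { apply Hout. lra. }
  set (W := (1 - u) ⊙ (z ⊖ x) ⊕ u ⊙ v).
  replace (x ⊕ t ⊙ (z ⊖ x) ⊕ u ⊙ (x ⊕ t ⊙ v ⊖ (x ⊕ t ⊙ (z ⊖ x)))) with (x ⊕ t ⊙ W) in Hy
    by (unfold W; vec).
  assert (HW : ‖(W)‖ <= C).
  { eapply Rle_trans; [apply norm_triangle|]. rewrite !norm_scal_pos by lra. unfold C. nra. }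
  assert (HW0 := norm_nonneg W).
  assert (Hnorm : ‖(t ⊙ W)‖ < e) by (rewrite norm_scal_pos by lra; nra).
  specialize (Hgrad (t ⊙ W) ltac:(lra)).
  rewrite (Hconst (x ⊕ t ⊙ W)) in Hgrad; [| |exact Hy].
  2:{ unfold hball. replace (x ⊕ t ⊙ W ⊖ x) with (t ⊙ W) by vec. lra. }
  rewrite inner_scal_r, norm_scal_pos in Hgrad by lra.
  replace (f x - f x - t * ⟨a, W⟩) with (- (t * ⟨a, W⟩)) in Hgrad by ring.
  rewrite Rabs_Ropp, Rabs_mult, (Rabs_pos_eq t) in Hgrad by lra.
  assert (HaW : Rabs ⟨a, W⟩ <= m / 2).
  { apply Rmult_le_reg_l with t; [easy|]. eapply Rle_trans; [apply Hgrad|].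
    replace (t * (m / 2)) with (m / (2 * C) * (t * C)) by (field; unfold C; lra).
    apply Rmult_le_compat_l; [|nra]. left. apply Rdiv_lt_0_compat; unfold C; lra. }
  assert (HaW' : ⟨a, W⟩ = (1 - u) * B + u * A) by (unfold W, A, B; inner_expand; ring).
  rewrite HaW' in HaW. apply Rabs_le_inv in HaW.
  destruct (Rlt_or_le A 0) as [HA|HA].
  - assert (HB : B < 0) by nra. rewrite Rabs_left in HmA, HmB by lra. nra.
  - assert (HB : 0 < B) by nra. rewrite Rabs_pos_eq in HmA, HmB by nra. nra.
Qed.

(** Every v with ⟨n, v⟩ > 0 leaves V at once, so ⟨a, v⟩ has a weakly constant sign on that open
    half-space, opposite to the sign of a fixed nonzero s = ⟨a, z - x⟩. Adding to n large multiples
    of s (a - c n), which is orthogonal to n, would break this unless a = c n. *)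
Lemma gradient_parallel_normal (f : X -> R) x a n r :
  hboundary V x -> outer_unit_normal V x n -> has_gradient f x a -> a <> hs_zero -> 0 < r ->
  (forall y, hball x r y -> hboundary V y -> f y = f x) ->
  exists c, c <> 0 /\ a = c ⊙ n.
Proof.
  intros Hx Hn Hf Ha Hr Hconst.
  assert (Hsign : forall z v, V z -> 0 < ⟨n, v⟩ -> ⟨a, v⟩ * ⟨a, z ⊖ x⟩ <= 0).
  { intros z v Hz Hv. apply (gradient_opposite_sign f x a v z r 1); try easy; [lra|].
    intros t Ht HVt. assert (H := proj2 Hn _ HVt). revert H. inner_expand. intros H.
    assert (H' : 0 < t * ⟨n, v⟩) by (apply Rmult_lt_0_compat; lra).
    lra. }
  assert (Hex : exists z, V z /\ ⟨a, z ⊖ x⟩ <> 0).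
  { destruct (proj2 (proj2 HV)) as [z Hz].
    destruct (Req_dec ⟨a, z ⊖ x⟩ 0) as [E|E].
    2:{ exists z. split; [now apply interior_in|easy]. }
    (* Moving z along [a] adds e |a|^2 to the vanishing product. *)
    destruct (interior_shift z a Hz) as [e [He HVe]]. exists (z ⊕ e ⊙ a). split; [easy|].
    replace ⟨a, z ⊕ e ⊙ a ⊖ x⟩ with (⟨a, z ⊖ x⟩ + e * ⟨a, a⟩) by (inner_expand; ring).
    rewrite E, <- norm_sq. assert (H := norm_pos a Ha).
    assert (H' : 0 < e * (‖(a)‖ * ‖(a)‖)) by (repeat apply Rmult_lt_0_compat; easy). lra. }
  destruct Hex as [z [Hz Hs]]. set (s := ⟨a, z ⊖ x⟩) in *. set (c := ⟨a, n⟩).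
  assert (Hnn := normal_unit x n Hn).
  assert (Horth : forall k, 0 < k -> s * c + k * (s * s) * ⟨a ⊖ c ⊙ n, a ⊖ c ⊙ n⟩ <= 0).
  { intros k Hk. assert (H := Hsign z (n ⊕ (k * s) ⊙ (a ⊖ c ⊙ n)) Hz).
    assert (H1 : ⟨n, n ⊕ (k * s) ⊙ (a ⊖ c ⊙ n)⟩ = 1).
    { inner_expand. rewrite (hs_inner_sym _ n a), Hnn. fold c. ring. }
    rewrite H1 in H. specialize (H Rlt_0_1). fold s in H.
    replace (⟨a, n ⊕ (k * s) ⊙ (a ⊖ c ⊙ n)⟩ * s)
      with (s * c + k * (s * s) * ⟨a ⊖ c ⊙ n, a ⊖ c ⊙ n⟩) in H; [easy|].
    inner_expand. rewrite (hs_inner_sym _ n a), Hnn. fold c. ring. }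
  assert (Hss : 0 < s * s) by nra.
  assert (Hq : ⟨a ⊖ c ⊙ n, a ⊖ c ⊙ n⟩ = 0).
  { destruct (hs_inner_pos X (a ⊖ c ⊙ n)) as [Hq|Hq]; [exfalso|easy].
    assert (Hp : 0 < s * s * ⟨a ⊖ c ⊙ n, a ⊖ c ⊙ n⟩) by nra.
    (* This [k] makes the second term of [Horth] equal to |s c| + 1, which outweighs s c. *)
    assert (H := Horth ((Rabs (s * c) + 1) / (s * s * ⟨a ⊖ c ⊙ n, a ⊖ c ⊙ n⟩))).
    assert (Habs := Rabs_pos (s * c)). assert (Habs' := Rle_abs (- (s * c))).
    rewrite Rabs_Ropp in Habs'.
    replace ((Rabs (s * c) + 1) / (s * s * ⟨a ⊖ c ⊙ n, a ⊖ c ⊙ n⟩) * (s * s)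
      * ⟨a ⊖ c ⊙ n, a ⊖ c ⊙ n⟩) with (Rabs (s * c) + 1) in H by (field; split; lra).
    enough (s * c + (Rabs (s * c) + 1) <= 0) by lra.
    apply H. apply Rdiv_lt_0_compat; lra. }
  assert (Hac : a = c ⊙ n).
  { apply hs_inner_def in Hq. replace a with (a ⊖ c ⊙ n ⊕ c ⊙ n) by vec. rewrite Hq. vec. }
  exists c. split; [|easy]. intros E. apply Ha. rewrite Hac, E. vec.
Qed.

End ConvexBody.
(** * The largest convex minorant *)

Section Minorant.
Context {X : HilbertSpace}.
Implicit Types (x y z v h : X) (u F b : X -> R) (B : (X -> R) -> Prop).

(** The convex envelope of the pointwise infimum of the family [B], described by maximality so that
    the infimum need not be formed. *)
Definition largest_convex_minorant B F : Prop :=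
  convex_fun F /\ (forall b x, B b -> F x <= b x) /\
  forall u, convex_fun u -> (forall b x, B b -> u x <= b x) -> forall x, u x <= F x.

(** A pointwise supremum of convex minorants is again one; [u0] makes the set of values nonempty and
    [b0] bounds it. *)
Lemma largest_convex_minorant_exists B u0 b0 :
  convex_fun u0 -> (forall b x, B b -> u0 x <= b x) -> B b0 ->
  exists F, largest_convex_minorant B F.
Proof.
  intros Hu0 Hu0B Hb0.
  set (U u := convex_fun u /\ forall b x, B b -> u x <= b x).
  assert (Hlub : forall x, exists m, is_lub (fun t => exists u, U u /\ t = u x) m).
  { intros x.
    destruct (completeness (fun t => exists u, U u /\ t = u x)) as [m Hm].
    - exists (b0 x). intros t (u & Hu & ->). now apply Hu.
    - exists (u0 x), u0. now split.
    - now exists m. }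
  destruct (choice _ Hlub) as [F HF].
  assert (HUF : forall u x, U u -> u x <= F x).
  { intros u x Hu. apply (HF x). now exists u. }
  exists F. repeat split.
  - intros x y l Hl. apply (HF (l ⊙ x ⊕ (1 - l) ⊙ y)). intros t (u & Hu & ->).
    eapply Rle_trans; [now apply (proj1 Hu)|].
    assert (H1 := HUF u x Hu). assert (H2 := HUF u y Hu).
    apply Rplus_le_compat; apply Rmult_le_compat_l; lra.
  - intros b x Hb. apply (HF x). intros t (u & Hu & ->). now apply Hu.
  - intros u Hu HuB x. now apply HUF.
Qed.

(* The average [(F (x ⊕ h) + F (x ⊖ h) - K) / 2] is again a convex minorant. *)
Lemma largest_convex_minorant_second_difference B F h K :
  largest_convex_minorant B F ->
  (forall b x, B b -> b (x ⊕ h) + b (x ⊖ h) - 2 * b x <= K) ->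
  forall x, F (x ⊕ h) + F (x ⊖ h) - 2 * F x <= K.
Proof.
  intros (Hconv & Hle & Hmax) HK x.
  enough ((F (x ⊕ h) + F (x ⊖ h) - K) / 2 <= F x) by lra.
  apply (Hmax (fun x => (F (x ⊕ h) + F (x ⊖ h) - K) / 2)).
  - intros y z l Hl.
    assert (H1 := Hconv (y ⊕ h) (z ⊕ h) l Hl). assert (H2 := Hconv (y ⊖ h) (z ⊖ h) l Hl).
    replace (l ⊙ (y ⊕ h) ⊕ (1 - l) ⊙ (z ⊕ h)) with (l ⊙ y ⊕ (1 - l) ⊙ z ⊕ h) in H1 by vec.
    replace (l ⊙ (y ⊖ h) ⊕ (1 - l) ⊙ (z ⊖ h)) with (l ⊙ y ⊕ (1 - l) ⊙ z ⊖ h) in H2 by vec.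
    lra.
  - intros b y Hb. specialize (HK b y Hb).
    assert (H1 := Hle b (y ⊕ h) Hb). assert (H2 := Hle b (y ⊖ h) Hb). lra.
Qed.

End Minorant.

(** * Second differences and differentiability of convex functions *)

Section SecondDifference.
Context {X : HilbertSpace} {w : R -> R} (Hw : modulus w).
Context (F : X -> R) (C : R) (HF : convex_fun F) (HC : 0 <= C).
Context (Hdiff : forall x h : X,
  F (x ⊕ h) + F (x ⊖ h) - 2 * F x <= C * (‖(h)‖ * w ‖(h)‖)).
Implicit Types x y z v h g : X.

Lemma modulus_remainder_small eps : 0 < eps -> exists delta, 0 < delta /\
  forall h, ‖(h)‖ < delta -> C * (‖(h)‖ * w ‖(h)‖) <= eps * ‖(h)‖.
Proof.
  intros Heps. destruct (modulus_small Hw (eps / (C + 1))) as [d [Hd Hsmall]].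
  { apply Rdiv_lt_0_compat; lra. }
  exists d. split; [easy|]. intros h Hh. assert (H0 := norm_nonneg h).
  replace (C * (‖(h)‖ * w ‖(h)‖)) with (C * w ‖(h)‖ * ‖(h)‖) by ring.
  apply Rmult_le_compat_r; [easy|].
  apply Rle_trans with (C * (eps / (C + 1))).
  { apply Rmult_le_compat_l; [easy|]. apply Hsmall. lra. }
  replace eps with (eps / (C + 1) * (C + 1)) at 2 by (field; lra).
  rewrite Rmult_comm. apply Rmult_le_compat_l; [|lra].
  left. apply Rdiv_lt_0_compat; lra.
Qed.

(** The subgradient inequality at x - h, inserted into the second difference, becomes an upper
    estimate at x + h; the one at x + h is the lower estimate. *)
Lemma subgradient_has_gradient x g :
  (forall y, F x + ⟨g, y ⊖ x⟩ <= F y) -> has_gradient F x g.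
Proof.
  intros Hg eps Heps. destruct (modulus_remainder_small eps Heps) as [d [Hd H]].
  exists d. split; [easy|]. intros h Hh. specialize (H h Hh).
  assert (H1 := Hg (x ⊕ h)). assert (H2 := Hg (x ⊖ h)). assert (H3 := Hdiff x h).
  replace (x ⊕ h ⊖ x) with h in H1 by vec.
  replace (x ⊖ h ⊖ x) with ((-1) ⊙ h) in H2 by vec. rewrite inner_scal_r in H2.
  rewrite Rabs_pos_eq by lra. lra.
Qed.

(** A subgradient at 0 of the restriction of F to a line, for t of both signs. Under the
    second-difference bound it is the directional derivative. *)
Definition slope x v l : Prop := forall t, F x + t * l <= F (x ⊕ t ⊙ v).

(** The slope is the supremum of the left difference quotients; by convexity ([Hchord]) each of them
    is at most every right one. *)
Lemma slope_exists x v : exists l, slope x v l.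
Proof.
  assert (Hchord : forall s t, 0 < s -> 0 < t ->
    t * (F x - F (x ⊕ (- s) ⊙ v)) <= s * (F (x ⊕ t ⊙ v) - F x)).
  { intros s t Hs Ht.
    assert (Hst : 0 <= s / (s + t) <= 1).
    { split; [apply Rmult_le_pos; [lra|]; left; apply Rinv_0_lt_compat; lra|].
      apply Rmult_le_reg_r with (s + t); [lra|].
      unfold Rdiv. rewrite Rmult_assoc, Rinv_l; lra. }
    assert (H := HF (x ⊕ t ⊙ v) (x ⊕ (- s) ⊙ v) (s / (s + t)) Hst).
    replace ((s / (s + t)) ⊙ (x ⊕ t ⊙ v) ⊕ (1 - s / (s + t)) ⊙ (x ⊕ (- s) ⊙ v))
      with x in H by (vec; lra).
    apply Rmult_le_compat_l with (r := s + t) in H; [|lra].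
    replace ((s + t) * (s / (s + t) * F (x ⊕ t ⊙ v) + (1 - s / (s + t)) * F (x ⊕ (- s) ⊙ v)))
      with (s * F (x ⊕ t ⊙ v) + t * F (x ⊕ (- s) ⊙ v)) in H by (field; lra).
    lra. }
  destruct (completeness (fun m => exists s, 0 < s /\ m = (F x - F (x ⊕ (- s) ⊙ v)) / s))
    as [l [Hub Hlub]].
  { exists (F (x ⊕ 1 ⊙ v) - F x). intros m (s & Hs & ->).
    assert (H := Hchord s 1 Hs Rlt_0_1).
    apply Rmult_le_reg_l with s; [easy|].
    replace (s * ((F x - F (x ⊕ (- s) ⊙ v)) / s)) with (F x - F (x ⊕ (- s) ⊙ v)) by (field; lra).
    lra. }
  { exists ((F x - F (x ⊕ (- (1)) ⊙ v)) / 1), 1. split; [lra|easy]. }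
  exists l. intros t. destruct (Rtotal_order t 0) as [Ht|[->|Ht]].
  - assert (H : (F x - F (x ⊕ (- - t) ⊙ v)) / (- t) <= l).
    { apply Hub. exists (- t). split; [lra|easy]. }
    rewrite Ropp_involutive in H.
    apply Rmult_le_compat_l with (r := - t) in H; [|lra].
    replace (- t * ((F x - F (x ⊕ t ⊙ v)) / - t)) with (F x - F (x ⊕ t ⊙ v)) in H
      by (field; lra). lra.
  - replace (x ⊕ 0 ⊙ v) with x by vec. lra.
  - assert (H : l <= (F (x ⊕ t ⊙ v) - F x) / t).
    { apply Hlub. intros m (s & Hs & ->). assert (H := Hchord s t Hs Ht).
      apply Rmult_le_reg_l with (s * t); [nra|].
      replace (s * t * ((F x - F (x ⊕ (- s) ⊙ v)) / s)) with (t * (F x - F (x ⊕ (- s) ⊙ v)))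
        by (field; lra).
      replace (s * t * ((F (x ⊕ t ⊙ v) - F x) / t)) with (s * (F (x ⊕ t ⊙ v) - F x))
        by (field; lra). easy. }
    apply Rmult_le_compat_l with (r := t) in H; [|lra].
    replace (t * ((F (x ⊕ t ⊙ v) - F x) / t)) with (F (x ⊕ t ⊙ v) - F x) in H by (field; lra).
    lra.
Qed.

Lemma slope_upper x v l eps : slope x v l -> 0 < eps ->
  exists delta, 0 < delta /\ forall t, 0 < t < delta -> F (x ⊕ t ⊙ v) <= F x + t * l + t * eps.
Proof.
  intros Hl Heps. assert (Hv := norm_nonneg v).
  destruct (modulus_remainder_small (eps / (‖(v)‖ + 1))) as [d [Hd H]].
  { apply Rdiv_lt_0_compat; lra. }
  exists (d / (‖(v)‖ + 1)). split; [apply Rdiv_lt_0_compat; lra|].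
  intros t [Ht Htd].
  assert (Htv : t * (‖(v)‖ + 1) < d).
  { replace d with (d / (‖(v)‖ + 1) * (‖(v)‖ + 1)) by (field; lra).
    apply Rmult_lt_compat_r; lra. }
  specialize (H (t ⊙ v)). rewrite norm_scal_pos in H by lra. specialize (H ltac:(nra)).
  assert (H1 := Hdiff x (t ⊙ v)). rewrite norm_scal_pos in H1 by lra.
  assert (H2 := Hl (- t)). replace (x ⊕ (- t) ⊙ v) with (x ⊖ t ⊙ v) in H2 by vec.
  assert (H3 : eps / (‖(v)‖ + 1) * (t * ‖(v)‖) <= t * eps).
  { replace (t * eps) with (eps / (‖(v)‖ + 1) * (t * (‖(v)‖ + 1))) by (field; lra).
    apply Rmult_le_compat_l; [left; apply Rdiv_lt_0_compat; lra|nra]. }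
  lra.
Qed.

(** The point x + t (u + v) is the midpoint of x + 2t u and x + 2t v, where [slope_upper] bounds F.
    The two errors add up to 2 t [eps], half of t times the assumed gap. *)
Lemma slope_sub x u v lu lv l : slope x u lu -> slope x v lv -> slope x (u ⊕ v) l ->
  l <= lu + lv.
Proof.
  intros Hu Hv Hl. apply Rnot_lt_le. intros Hlt.
  set (eps := (l - (lu + lv)) / 4).
  destruct (slope_upper x u lu eps Hu) as [d1 [Hd1 H1]]; [unfold eps; lra|].
  destruct (slope_upper x v lv eps Hv) as [d2 [Hd2 H2]]; [unfold eps; lra|].
  assert (Hd : 0 < Rmin d1 d2) by now apply Rmin_pos.
  assert (Hdl := Rmin_l d1 d2). assert (Hdr := Rmin_r d1 d2).
  set (t := Rmin d1 d2 / 4). assert (Ht : 0 < t) by (unfold t; lra).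
  specialize (H1 (2 * t) ltac:(unfold t; lra)). specialize (H2 (2 * t) ltac:(unfold t; lra)).
  assert (H3 := HF (x ⊕ (2 * t) ⊙ u) (x ⊕ (2 * t) ⊙ v) (/ 2) ltac:(lra)).
  replace (/ 2 ⊙ (x ⊕ (2 * t) ⊙ u) ⊕ (1 - / 2) ⊙ (x ⊕ (2 * t) ⊙ v)) with (x ⊕ t ⊙ (u ⊕ v))
    in H3 by vec.
  assert (H4 := Hl t).
  assert (H5 : t * (l - lu - lv) <= 2 * t * eps) by lra.
  unfold eps in H5. nra.
Qed.

Lemma slope_scal x v l a : slope x v l -> slope x (a ⊙ v) (a * l).
Proof.
  intros H t. replace (x ⊕ t ⊙ (a ⊙ v)) with (x ⊕ (t * a) ⊙ v) by vec.
  rewrite <- Rmult_assoc. apply H.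
Qed.

Lemma slope_zero x : slope x hs_zero 0.
Proof. intros t. replace (x ⊕ t ⊙ hs_zero) with x by vec. lra. Qed.

(** [slope_sub] compares arbitrary slopes, so adding the zero vector, with slope 0, compares two
    slopes in the same direction. *)
Lemma slope_unique x v l l' : slope x v l -> slope x v l' -> l = l'.
Proof.
  assert (Hle : forall l l', slope x v l -> slope x v l' -> l <= l').
  { clear l l'. intros l l' H H'.
    rewrite <- (Rplus_0_r l'). apply (slope_sub x v hs_zero); try easy.
    - apply slope_zero.
    - now replace (v ⊕ hs_zero) with v by vec. }
  intros H H'. apply Rle_antisym; auto.
Qed.

Context (Hbound : forall x, exists K, forall v, ‖(v)‖ <= 1 -> F (x ⊕ v) <= K).

(** Uniqueness makes the slope homogeneous in v; homogeneity for the factor -1 upgrades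
    subadditivity to additivity. The local upper bound of F supplies the continuity required by
    [riesz]. *)
Lemma subgradient_exists x : exists g, forall y, F x + ⟨g, y ⊖ x⟩ <= F y.
Proof.
  destruct (choice _ (slope_exists x)) as [l Hl].
  destruct (Hbound x) as [K HK].
  assert (Hscal : forall a v, l (a ⊙ v) = a * l v).
  { intros a v. apply (slope_unique x (a ⊙ v)); [apply Hl|]. apply slope_scal, Hl. }
  assert (Hadd : forall u v, l (u ⊕ v) = l u + l v).
  { intros u v. apply Rle_antisym; [now apply (slope_sub x u v)|].
    assert (H := slope_sub x _ _ _ _ _ (Hl ((-1) ⊙ u)) (Hl ((-1) ⊙ v))
      (Hl ((-1) ⊙ u ⊕ (-1) ⊙ v))).
    replace ((-1) ⊙ u ⊕ (-1) ⊙ v) with ((-1) ⊙ (u ⊕ v)) in H by vec.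
    rewrite !Hscal in H. lra. }
  destruct (riesz l (K - F x) Hadd Hscal) as [g Hg].
  { intros v. destruct (norm_nonneg v) as [Hv|Hv].
    - assert (H := Hl v (/ ‖(v)‖)).
      assert (Hn : ‖(/ ‖(v)‖ ⊙ v)‖ = 1).
      { rewrite norm_scal_pos by (left; now apply Rinv_0_lt_compat). field. lra. }
      assert (H' := HK (/ ‖(v)‖ ⊙ v) ltac:(lra)).
      replace (l v) with (/ ‖(v)‖ * l v * ‖(v)‖) by (field; lra).
      apply Rmult_le_compat_r; lra.
    - symmetry in Hv. rewrite Hv, Rmult_0_r. apply norm_eq0 in Hv. subst v.
      replace (@hs_zero X) with (0 ⊙ @hs_zero X) by vec. rewrite Hscal. lra. }
  exists g. intros y. rewrite <- Hg. assert (H := Hl (y ⊖ x) 1).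
  replace (x ⊕ 1 ⊙ (y ⊖ x)) with y in H by vec. lra.
Qed.

Lemma second_difference_C1omega : C1omega w F.
Proof.
  destruct (choice _ subgradient_exists) as [G HG].
  (* The 4 comes from |k| <= 2r and w(2r) <= 2 w(r) below; adding 1 keeps the constant positive when
     C = 0. *)
  exists G, (4 * C + 1). split; [lra|]. split.
  { intros x. now apply subgradient_has_gradient. }
  intros x y. set (d := ‖(G x ⊖ G y)‖). set (r := ‖(x ⊖ y)‖).
  assert (Hr0 : 0 <= r) by apply norm_nonneg.
  assert (Hwr := modulus_nonneg Hw r Hr0).
  destruct (norm_nonneg (G x ⊖ G y)) as [Hd|Hd]; fold d in Hd.
  2:{ rewrite <- Hd. nra. }
  destruct Hr0 as [Hr|Hr].
  2:{ symmetry in Hr. apply norm_eq0 in Hr.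
      assert (E : x = y).
      { replace x with (x ⊖ y ⊕ y) by vec. rewrite Hr. vec. }
      subst y. unfold d in Hd. replace (G x ⊖ G x) with (@hs_zero X) in Hd by vec.
      rewrite norm_zero in Hd. lra. }
  (* Compare the tangents at [x] and [y] at the point [x ⊕ h], for the [h] of length [r] along
     which they differ most. *)
  set (h := (r / d) ⊙ (G x ⊖ G y)).
  assert (Hrd : 0 < r / d) by now apply Rdiv_lt_0_compat.
  assert (Hh : ‖(h)‖ = r).
  { unfold h. rewrite norm_scal_pos by lra. fold d. field. lra. }
  assert (Hgh : ⟨G x ⊖ G y, h⟩ = r * d).
  { unfold h. rewrite inner_scal_r, <- norm_sq. fold d. field. lra. }
  set (k := x ⊕ h ⊖ y).
  assert (Hk : ‖(k)‖ <= 2 * r).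
  { replace k with (x ⊖ y ⊕ h) by (unfold k; vec).
    eapply Rle_trans; [apply norm_triangle|]. rewrite Hh. fold r. lra. }
  assert (H1 := HG x (x ⊕ h)). assert (H2 := HG y x).
  assert (H3 := HG y (y ⊖ k)). assert (H4 := Hdiff y k).
  replace (y ⊕ k) with (x ⊕ h) in H4 by (unfold k; vec).
  assert (Hk0 := norm_nonneg k).
  assert (H5 : ‖(k)‖ * w ‖(k)‖ <= 2 * r * w (2 * r)).
  { apply Rmult_le_compat; [easy|now apply modulus_nonneg|easy|].
    now apply modulus_mono. }
  assert (H6 := modulus_scale_le Hw 2 r ltac:(lra) ltac:(lra)).
  (* In the sum of the three tangent inequalities and the second difference at y, all values of F
     cancel. *)
  assert (H7 : r * d <= C * (‖(k)‖ * w ‖(k)‖)).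
  { assert (Hyk : ⟨G y, y ⊖ k ⊖ y⟩ = - (⟨G y, x ⊖ y⟩ + ⟨G y, h⟩)).
    { unfold k. inner_expand. ring. }
    replace (x ⊕ h ⊖ x) with h in H1 by vec. rewrite inner_sub_l in Hgh. lra. }
  assert (H8 : C * (‖(k)‖ * w ‖(k)‖) <= C * (2 * r * (2 * w r))).
  { apply Rmult_le_compat_l; [easy|]. eapply Rle_trans; [apply H5|].
    apply Rmult_le_compat_l; lra. }
  assert (H9 : r * d <= r * (4 * C * w r)) by lra.
  apply Rmult_le_reg_l in H9; [lra|easy].
Qed.

End SecondDifference.
(** * The integral of a modulus *)

Section Integral.
Context {w phi : R -> R} (Hw : modulus w).
Context (Hphi : forall t, 0 <= t -> exists pr : Riemann_integrable w 0 t, RiemannInt pr = phi t).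

Lemma integral_nonneg t : 0 <= t -> 0 <= phi t.
Proof.
  intros Ht. assert (H := integral_tangent Hw phi Hphi 0 t (Rle_refl 0) Ht).
  rewrite (integral_zero phi Hphi) in H.
  assert (H' := modulus_nonneg Hw 0 (Rle_refl 0)). nra.
Qed.

Lemma integral_mono s t : 0 <= s -> s <= t -> phi s <= phi t.
Proof.
  intros Hs Hst. assert (H := integral_tangent Hw phi Hphi s t Hs ltac:(lra)).
  assert (H' := modulus_nonneg Hw s Hs). nra.
Qed.

Lemma integral_le t : 0 <= t -> phi t <= t * w t.
Proof.
  intros Ht. assert (H := integral_tangent Hw phi Hphi t 0 Ht (Rle_refl 0)).
  rewrite (integral_zero phi Hphi) in H. lra.
Qed.

Lemma integral_double_ge t : 0 <= t -> t * w t <= phi (2 * t).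
Proof.
  intros Ht. assert (H := integral_tangent Hw phi Hphi t (2 * t) Ht ltac:(lra)).
  assert (H' := integral_nonneg t Ht). lra.
Qed.

Lemma integral_ge t : 0 <= t -> t * w t <= 4 * phi t.
Proof.
  intros Ht. assert (H := integral_double_ge (t / 2) ltac:(lra)).
  replace (2 * (t / 2)) with t in H by field.
  assert (H' := modulus_scale_le Hw 2 (t / 2) ltac:(lra) ltac:(lra)).
  replace (2 * (t / 2)) with t in H' by field. nra.
Qed.

(** This is convexity of [phi] with [phi 0 = 0]: the tangent at s t lies below [phi] both at t and
    at 0. It makes the interior bodies star-shaped. *)
Lemma integral_star s t : 0 <= s <= 1 -> 0 <= t -> phi (s * t) <= s * phi t.
Proof.
  intros Hs Ht. assert (Hst : 0 <= s * t) by nra.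
  assert (H1 := integral_tangent Hw phi Hphi (s * t) t Hst Ht).
  assert (H2 := integral_le (s * t) Hst).
  apply Rmult_le_compat_l with (r := s) in H1; [|lra].
  apply Rmult_le_compat_l with (r := 1 - s) in H2; [|lra].
  lra.
Qed.

(** Expanding [phi] at a = |x| costs b w(b) for each of the two points, where b = |h|. The
    first-order term w(a)(p + q - 2a) is at most 2b w(b): if a <= b by the triangle inequality,
    otherwise because p + q - 2a <= b^2 / a by the parallelogram identity and w(a)/a <= w(b)/b. *)
Lemma integral_norm_second_difference {X : HilbertSpace} (x h : X) :
  phi ‖(x ⊕ h)‖ + phi ‖(x ⊖ h)‖ - 2 * phi ‖(x)‖ <= 4 * (‖(h)‖ * w ‖(h)‖).
Proof.
  set (a := ‖(x)‖). set (b := ‖(h)‖). set (p := ‖(x ⊕ h)‖). set (q := ‖(x ⊖ h)‖).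
  assert (Ha : 0 <= a) by apply norm_nonneg. assert (Hb : 0 <= b) by apply norm_nonneg.
  assert (Hp : 0 <= p) by apply norm_nonneg. assert (Hq : 0 <= q) by apply norm_nonneg.
  assert (Hpa : Rabs (p - a) <= b).
  { unfold b. replace h with (x ⊕ h ⊖ x) by vec. apply norm_rev_triangle. }
  assert (Hqa : Rabs (q - a) <= b).
  { unfold b. replace h with (x ⊖ (x ⊖ h)) by vec. rewrite (norm_sub_sym x).
    apply norm_rev_triangle. }
  assert (Hpar : p * p + q * q = 2 * (a * a) + 2 * (b * b)).
  { unfold p, q, a, b. rewrite !norm_sq. inner_expand. ring. }
  assert (Hwb := modulus_nonneg Hw b Hb). assert (Hwa := modulus_nonneg Hw a Ha).
  assert (Hfirst : forall s, 0 <= s -> Rabs (s - a) <= b ->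
    phi s - phi a <= w a * (s - a) + b * w b).
  { intros s Hs Hsa. apply Rabs_le_inv in Hsa.
    assert (H := integral_tangent Hw phi Hphi s a Hs Ha).
    destruct (Rle_or_lt a s) as [Has|Has].
    - assert (H1 := modulus_subadditive Hw a (s - a) Ha ltac:(lra)).
      replace (a + (s - a)) with s in H1 by ring.
      assert (H2 := modulus_mono Hw (s - a) b ltac:(lra) ltac:(lra)).
      assert (H3 : w s * (s - a) <= (w a + w b) * (s - a)) by (apply Rmult_le_compat_r; lra).
      assert (H4 : (s - a) * w b <= b * w b) by (apply Rmult_le_compat_r; lra).
      lra.
    - assert (H1 := modulus_subadditive Hw s (a - s) Hs ltac:(lra)).
      replace (s + (a - s)) with a in H1 by ring.
      assert (H2 := modulus_mono Hw (a - s) b ltac:(lra) ltac:(lra)).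
      assert (H3 : (w a - w b) * (a - s) <= w s * (a - s)) by (apply Rmult_le_compat_r; lra).
      assert (H4 : (a - s) * w b <= b * w b) by (apply Rmult_le_compat_r; lra).
      lra. }
  assert (H1 := Hfirst p Hp Hpa). assert (H2 := Hfirst q Hq Hqa).
  apply Rabs_le_inv in Hpa. apply Rabs_le_inv in Hqa.
  enough (w a * (p + q - 2 * a) <= 2 * (b * w b)) by lra.
  destruct (Rle_or_lt (p + q - 2 * a) 0) as [Hneg|Hpos].
  { assert (0 <= b * w b) by nra. nra. }
  destruct (Rle_or_lt a b) as [Hab|Hab].
  - assert (H3 := modulus_mono Hw a b Ha Hab).
    replace (2 * (b * w b)) with (w b * (2 * b)) by ring.
    apply Rmult_le_compat; lra.
  - assert (H3 := modulus_linear_le Hw b a ltac:(lra) ltac:(lra)).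
    assert (H4 : a * (p + q - 2 * a) <= b * b).
    { assert ((p + q) * (p + q) <= 4 * (a * a) + 4 * (b * b)).
      { assert (H := Rle_0_sqr (p - q)). unfold Rsqr in H. lra. }
      nra. }
    assert (H5 : a * (w a * (p + q - 2 * a)) <= a * (b * w b)).
    { apply Rle_trans with (w a * (b * b)).
      - replace (a * (w a * (p + q - 2 * a))) with (w a * (a * (p + q - 2 * a))) by ring.
        now apply Rmult_le_compat_l.
      - replace (w a * (b * b)) with (b * (b * w a)) by ring.
        replace (a * (b * w b)) with (b * (a * w b)) by ring.
        now apply Rmult_le_compat_l. }
    apply Rmult_le_reg_l in H5; [|lra]. assert (0 <= b * w b) by nra. lra.
Qed.

End Integral.

(** * Moduli for the normal field and defining functions *)

Section Equivalences.
Context {X : HilbertSpace} {V : X -> Prop} {N : X -> X} {w phi : R -> R}.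
Context (HV : hconvex_body V).
Context (HN : forall x, hboundary V x -> outer_unit_normal V x (N x)).
Context (Hw : modulus w).
Implicit Types (x y z p v n a : X).

Lemma normal_norm x : hboundary V x -> ‖(N x)‖ = 1.
Proof. intros Hx. apply (HN x Hx). Qed.

Lemma normal_le x y : hboundary V x -> V y -> ⟨N x, y ⊖ x⟩ <= 0.
Proof. intros Hx Hy. now apply (HN x Hx). Qed.

(** * From the modulus of the normal to interior bodies *)

Section ModulusAndBodies.
Context (HS : C1_hypersurface (hboundary V)).
Context (Hphi : forall t, 0 <= t -> exists pr : Riemann_integrable w 0 t, RiemannInt pr = phi t).

(** At a corner this would fail. Here the gradient of a local defining function is a nonzero
    multiple of the normal; if v left V at once, that gradient would take values of weakly opposite
    signs on v and on z - x, yet the normal is negative on both. *)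
Lemma inward_direction x v : hboundary V x -> ⟨N x, v⟩ < 0 ->
  forall d, 0 < d -> exists t, 0 < t < d /\ V (x ⊕ t ⊙ v).
Proof.
  intros Hx Hv d Hd. apply NNPP. intros Hno.
  destruct (HS x Hx) as (r & Hr & g & G & Hgrad & _ & Hzero).
  assert (Hxr : hball x r x).
  { unfold hball. replace (x ⊖ x) with (@hs_zero X) by vec. now rewrite norm_zero. }
  destruct (Hgrad x Hxr) as [Hgx Hne].
  assert (Hconst : forall y, hball x r y -> hboundary V y -> g y = g x).
  { intros y Hy HSy. rewrite (proj1 (Hzero x Hxr) Hx). now apply (Hzero y Hy). }
  destruct (gradient_parallel_normal HV g x (G x) (N x) r Hx (HN x Hx) Hgx Hne Hr Hconst)
    as [c [Hc HGc]].
  destruct (proj2 (proj2 HV)) as [z Hz].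
  assert (Hzx := normal_interior x z (N x) (HN x Hx) Hz).
  assert (H := gradient_opposite_sign HV g x (G x) v z r d Hx Hgx Hr Hconst
    (interior_in z Hz) Hd ltac:(intros t Ht HVt; apply Hno; now exists t)).
  rewrite HGc, !hs_inner_scal_l in H.
  assert (Hcc : 0 < c * c) by nra.
  assert (Hpp : 0 < ⟨N x, v⟩ * ⟨N x, z ⊖ x⟩) by nra.
  nra.
Qed.

(** Since N q supports V at q, ⟨N x, x - q⟩ is at most ⟨N x - N q, x - q⟩ <= M r w(r) <= M phi(2r).
    The factor 2 in the conclusion makes the inequality strict. *)
Lemma normal_modulus_excludes_boundary M x q : 0 < M ->
  (forall x y, hboundary V x -> hboundary V y -> ‖(N x ⊖ N y)‖ <= M * w ‖(x ⊖ y)‖) ->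
  hboundary V x -> hboundary V q -> q <> x ->
  ⟨N x, x ⊖ q⟩ < 2 * M * phi (2 * ‖(x ⊖ q)‖).
Proof.
  intros HM H1 Hx Hq Hne. set (r := ‖(x ⊖ q)‖).
  assert (Hr : 0 < r).
  { apply norm_pos. intros E. apply Hne.
    replace q with (x ⊖ (x ⊖ q)) by vec. rewrite E. vec. }
  assert (Hnq := normal_le q x Hq (boundary_in HV x Hx)).
  assert (Hcs := cauchy_schwarz (N x ⊖ N q) (x ⊖ q)). fold r in Hcs.
  assert (Hmod := H1 x q Hx Hq). fold r in Hmod.
  assert (Hphir := integral_double_ge Hw Hphi r ltac:(lra)).
  assert (Hwr := modulus_pos Hw r Hr).
  rewrite inner_sub_l in Hcs.
  assert (‖(N x ⊖ N q)‖ * r <= M * w r * r) by (apply Rmult_le_compat_r; lra).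
  assert (M * (r * w r) <= M * phi (2 * r)) by (apply Rmult_le_compat_l; lra).
  assert (0 < M * (r * w r)) by (repeat apply Rmult_lt_0_compat; easy).
  lra.
Qed.

Lemma normal_modulus_interior_bodies M : 0 < M ->
  (forall x y, hboundary V x -> hboundary V y -> ‖(N x ⊖ N y)‖ <= M * w ‖(x ⊖ y)‖) ->
  forall x, hboundary V x ->
    let W := fun p => ⟨N x, x ⊖ p⟩ >= 2 * M * phi (2 * ‖(x ⊖ p)‖) in
    (forall p, W p -> V p) /\ (forall p, hboundary V p /\ W p <-> p = x).
Proof.
  intros HM H1 x Hx W.
  assert (Hnot : forall q, hboundary V q -> W q -> q = x).
  { intros q Hq HWq. apply NNPP. intros Hne.
    assert (H := normal_modulus_excludes_boundary M x q HM H1 Hx Hq Hne).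
    unfold W in HWq. lra. }
  split.
  2:{ intros p. split; [intros [Hp HWp]; now apply Hnot|]. intros ->. split; [easy|].
    unfold W. replace (x ⊖ x) with (@hs_zero X) by vec.
    rewrite norm_zero, inner_zero_r, Rmult_0_r, (integral_zero phi Hphi). lra. }
  (* [W] is star-shaped about [x], so a segment from [x] to a point of [W] outside [V], which
     starts inside [V], would meet the boundary again within [W]. *)
  intros p HWp. apply NNPP. intros Hp. unfold W in HWp.
  assert (Hr : 0 <= ‖(x ⊖ p)‖) by apply norm_nonneg.
  assert (Hr0 : 0 < ‖(x ⊖ p)‖).
  { apply norm_pos. intros E. apply Hp. replace p with (x ⊖ (x ⊖ p)) by vec. rewrite E.
    replace (x ⊖ hs_zero) with x by vec. now apply boundary_in. }
  assert (Hin : ⟨N x, p ⊖ x⟩ < 0).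
  { assert (H := integral_double_ge Hw Hphi ‖(x ⊖ p)‖ Hr).
    assert (H' := modulus_pos Hw _ Hr0).
    assert (0 < ‖(x ⊖ p)‖ * w ‖(x ⊖ p)‖) by now apply Rmult_lt_0_compat.
    assert (0 < 2 * M * phi (2 * ‖(x ⊖ p)‖)) by (apply Rmult_lt_0_compat; lra).
    revert HWp. inner_expand. lra. }
  destruct (inward_direction x (p ⊖ x) Hx Hin 1 Rlt_0_1) as [t [Ht HVt]].
  destruct (boundary_crossing HV _ p HVt Hp) as [u [Hu Hq]].
  set (s := t + u * (1 - t)).
  (* Starting from the inward step at t > 0 keeps the crossing away from x itself. *)
  assert (Hs : 0 < s <= 1) by (unfold s; nra).
  replace (x ⊕ t ⊙ (p ⊖ x) ⊕ u ⊙ (p ⊖ (x ⊕ t ⊙ (p ⊖ x)))) with (x ⊕ s ⊙ (p ⊖ x)) in Hq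
    by (unfold s; vec).
  assert (Exq : x ⊖ (x ⊕ s ⊙ (p ⊖ x)) = s ⊙ (x ⊖ p)) by vec.
  assert (E : x ⊕ s ⊙ (p ⊖ x) = x).
  { apply Hnot; [easy|]. unfold W. rewrite Exq, norm_scal_pos, inner_scal_r by lra.
    replace (2 * (s * ‖(x ⊖ p)‖)) with (s * (2 * ‖(x ⊖ p)‖)) by ring.
    assert (H := integral_star Hw Hphi s (2 * ‖(x ⊖ p)‖) ltac:(lra) ltac:(lra)).
    apply Rle_ge. apply Rle_trans with (2 * M * (s * phi (2 * ‖(x ⊖ p)‖))).
    - apply Rmult_le_compat_l; lra.
    - replace (2 * M * (s * phi (2 * ‖(x ⊖ p)‖)))
        with (s * (2 * M * phi (2 * ‖(x ⊖ p)‖))) by ring.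
      apply Rmult_le_compat_l; lra. }
  rewrite E in Exq. assert (H : ‖(x ⊖ x)‖ = s * ‖(x ⊖ p)‖).
  { rewrite Exq. apply norm_scal_pos. lra. }
  replace (x ⊖ x) with (@hs_zero X) in H by vec. rewrite norm_zero in H. nra.
Qed.

(* The interior body at [x] contains the point at distance [omega_inv w (‖(N x ⊖ N y)‖ / (8 * M))]
   from [x] in the direction [N y ⊖ N x]. *)
Lemma interior_bodies_normal_inequality M : 0 < M ->
  (forall x, hboundary V x -> forall p,
     ⟨N x, x ⊖ p⟩ >= M * phi (2 * ‖(x ⊖ p)‖) -> V p) ->
  forall x y, hboundary V x -> hboundary V y ->
    ⟨N y, y ⊖ x⟩ >= ‖(N x ⊖ N y)‖ / 2 * omega_inv w (‖(N x ⊖ N y)‖ / (4 * (2 * M))).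
Proof.
  intros HM H2 x y Hx Hy. set (d := ‖(N x ⊖ N y)‖).
  assert (Hd0 : 0 <= d) by apply norm_nonneg.
  assert (Hyx := normal_le y x Hy (boundary_in HV x Hx)).
  destruct Hd0 as [Hd|Hd].
  2:{ rewrite <- Hd. revert Hyx. inner_expand. lra. }
  replace (4 * (2 * M)) with (8 * M) by ring.
  assert (HdM : 0 < d / (8 * M)) by (apply Rdiv_lt_0_compat; lra).
  destruct (omega_inv_spec Hw (d / (8 * M)) ltac:(lra)) as [Hr Hwr].
  set (r := omega_inv w (d / (8 * M))) in *.
  (* The 8 fits the membership test for x + h: M phi(2r) <= 4 M r w(r) = r d / 2, which is exactly
     -⟨N x, h⟩. *)
  assert (Hdr : d = 8 * M * w r) by (rewrite Hwr; field; lra).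
  assert (Hdd := norm_unit_dist (N x) (N y) (normal_norm x Hx) (normal_norm y Hy)).
  fold d in Hdd.
  assert (Hxx := normal_unit x _ (HN x Hx)). assert (Hyy := normal_unit y _ (HN y Hy)).
  set (h := (r / d) ⊙ (N y ⊖ N x)).
  assert (Hrd : 0 <= r / d).
  { apply Rmult_le_pos; [easy|]. left. now apply Rinv_0_lt_compat. }
  assert (Hh : ‖(h)‖ = r).
  { unfold h. rewrite norm_scal_pos, norm_sub_sym by easy. fold d. field. lra. }
  assert (HNx : ⟨N x, h⟩ = - (r * d / 2)).
  { unfold h. inner_expand. rewrite Hxx. replace ⟨N x, N y⟩ with (1 - d * d / 2) by lra.
    field. lra. }
  assert (HNy : ⟨N y, h⟩ = r * d / 2).
  { unfold h. inner_expand. rewrite Hyy, (hs_inner_sym _ (N y) (N x)).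
    replace ⟨N x, N y⟩ with (1 - d * d / 2) by lra. field. lra. }
  assert (HVh : V (x ⊕ h)).
  { apply (H2 x Hx). replace (x ⊖ (x ⊕ h)) with ((-1) ⊙ h) by vec.
    rewrite inner_scal_r, HNx, norm_scal, Rabs_left, Hh by lra.
    replace (- (-1) * r) with r by ring.
    assert (H3 := integral_le Hw Hphi (2 * r) ltac:(lra)).
    assert (H4 := modulus_scale_le Hw 2 r ltac:(lra) Hr).
    assert (H5 : 2 * r * w (2 * r) <= 2 * r * (2 * w r)) by (apply Rmult_le_compat_l; lra).
    assert (H6 : M * phi (2 * r) <= M * (4 * r * w r)) by (apply Rmult_le_compat_l; lra).
    replace (-1 * - (r * d / 2)) with (M * (4 * r * w r)) by (rewrite Hdr; field). lra. }
  assert (H := normal_le y _ Hy HVh).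
  replace (x ⊕ h ⊖ y) with (h ⊖ (y ⊖ x)) in H by vec.
  rewrite inner_sub_r, HNy in H. lra.
Qed.

End ModulusAndBodies.

(** The inequality added to its mirror image gives d s <= ⟨N x - N y, x - y⟩ <= d r, with s the
    inverse modulus of d / (4M). Hence s <= r, and applying [w] finishes. *)
Lemma normal_inequality_modulus M : 0 < M ->
  (forall x y, hboundary V x -> hboundary V y ->
    ⟨N y, y ⊖ x⟩ >= ‖(N x ⊖ N y)‖ / 2 * omega_inv w (‖(N x ⊖ N y)‖ / (4 * M))) ->
  forall x y, hboundary V x -> hboundary V y -> ‖(N x ⊖ N y)‖ <= 4 * M * w ‖(x ⊖ y)‖.
Proof.
  intros HM H3 x y Hx Hy.
  assert (Hxy := H3 x y Hx Hy). assert (Hyx := H3 y x Hy Hx).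
  rewrite (norm_sub_sym (N y)) in Hyx.
  set (d := ‖(N x ⊖ N y)‖) in *. set (r := ‖(x ⊖ y)‖).
  assert (Hr : 0 <= r) by apply norm_nonneg.
  assert (Hd0 : 0 <= d) by apply norm_nonneg.
  assert (Hwr := modulus_nonneg Hw r Hr).
  destruct Hd0 as [Hd|Hd]; [|rewrite <- Hd; nra].
  destruct (omega_inv_spec Hw (d / (4 * M))) as [Hs Hws].
  { left. apply Rdiv_lt_0_compat; lra. }
  set (s := omega_inv w (d / (4 * M))) in *.
  assert (Hcs := cauchy_schwarz (N x ⊖ N y) (x ⊖ y)). fold d r in Hcs.
  assert (Hds : d * s <= d * r) by (revert Hxy Hyx Hcs; inner_expand; lra).
  apply Rmult_le_reg_l in Hds; [|easy].
  assert (H := modulus_mono Hw s r Hs Hds). rewrite Hws in H.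
  replace d with (4 * M * (d / (4 * M))) by (field; lra).
  apply Rmult_le_compat_l; lra.
Qed.

Lemma half_space_function y0 : hboundary V y0 ->
  (forall y, hboundary V y -> N y = N y0) ->
  exists F : X -> R, convex_fun F /\ C1omega w F /\
    (forall x, hboundary V x <-> F x = 1) /\
    (forall x, hboundary V x -> has_gradient F x (N x)).
Proof.
  intros Hy0 Hconst. exists (fun x => 1 + ⟨N y0, x ⊖ y0⟩).
  split; [apply affine_convex|]. split; [|split].
  - exists (fun _ => N y0), 1. split; [lra|]. split.
    + intros x. apply affine_gradient.
    + intros x y. replace (N y0 ⊖ N y0) with (@hs_zero X) by vec. rewrite norm_zero.
      assert (H := modulus_nonneg Hw _ (norm_nonneg (x ⊖ y))). lra.
  - intros x. split; intros Hx.
    + assert (H1 := normal_le y0 x Hy0 (boundary_in HV x Hx)).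
      assert (H2 := normal_le x y0 Hx (boundary_in HV y0 Hy0)).
      rewrite (Hconst x Hx) in H2. revert H1 H2. inner_expand. lra.
    + assert (HVx : V x).
      { apply NNPP. intros Hno. destruct (exists_separating_normal HV N x HN Hno) as [y [Hy Hs]].
        assert (H := normal_le y y0 Hy (boundary_in HV y0 Hy0)).
        rewrite (Hconst y Hy) in Hs, H. revert Hs H Hx. inner_expand. lra. }
      split; [now apply closure_in|]. intros Hint.
      assert (H := normal_interior y0 x (N y0) (HN y0 Hy0) Hint). lra.
  - intros x Hx. rewrite (Hconst x Hx). apply affine_gradient.
Qed.

Lemma boundary_exit x y v : hinterior V x -> hboundary V y -> 0 < ⟨N y, v⟩ ->
  exists t, 0 < t /\ hboundary V (x ⊕ t ⊙ v).
Proof.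
  intros Hx Hy Hv.
  assert (Hyx := normal_interior y x (N y) (HN y Hy) Hx).
  (* At this time the ray has reached height 1 above the supporting hyperplane at y. *)
  set (T := (1 - ⟨N y, x ⊖ y⟩) / ⟨N y, v⟩).
  assert (HT : 0 < T) by (apply Rdiv_lt_0_compat; lra).
  assert (Hout : ~ V (x ⊕ T ⊙ v)).
  { intros HVT. assert (H := normal_le y _ Hy HVT).
    replace ⟨N y, x ⊕ T ⊙ v ⊖ y⟩ with (⟨N y, x ⊖ y⟩ + T * ⟨N y, v⟩) in H by (inner_expand; ring).
    replace (T * ⟨N y, v⟩) with (1 - ⟨N y, x ⊖ y⟩) in H by (unfold T; field; lra). lra. }
  destruct (boundary_crossing HV x _ (interior_in x Hx) Hout) as [u [Hu HSu]].
  replace (x ⊕ u ⊙ (x ⊕ T ⊙ v ⊖ x)) with (x ⊕ (u * T) ⊙ v) in HSu by vec.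
  exists (u * T). split; [|easy].
  destruct (proj1 Hu) as [Hu0|<-]; [nra|]. exfalso.
  apply (proj2 HSu). now replace (x ⊕ (0 * T) ⊙ v) with x by vec.
Qed.

(* The two boundary points lie on the line through [x] with direction [N y1 ⊖ N y2]; the gradient
   of [F] at one of them points outward, which makes the inequality strict. *)
Lemma convex_lt_1_interior (F : X -> R) y1 y2 x : convex_fun F ->
  (forall y, hboundary V y -> F y = 1) -> (forall y, hboundary V y -> has_gradient F y (N y)) ->
  hboundary V y1 -> hboundary V y2 -> N y1 <> N y2 -> hinterior V x -> F x < 1.
Proof.
  intros HF HF1 Hgrad Hy1 Hy2 Hne Hx.
  (* Distinct unit vectors have product below 1, so N y1 - N y2 has positive product with N y1 and
     negative product with N y2: both ends of the line leave V. *)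
  assert (Hpos : 0 < 1 - ⟨N y1, N y2⟩).
  { assert (H := norm_unit_dist _ _ (normal_norm y1 Hy1) (normal_norm y2 Hy2)).
    assert (H' : 0 < ‖(N y1 ⊖ N y2)‖).
    { apply norm_pos. intros E. apply Hne. replace (N y1) with (N y1 ⊖ N y2 ⊕ N y2) by vec.
      rewrite E. vec. }
    nra. }
  assert (H11 := normal_unit y1 _ (HN y1 Hy1)). assert (H22 := normal_unit y2 _ (HN y2 Hy2)).
  destruct (boundary_exit x y1 (N y1 ⊖ N y2) Hx Hy1) as [s [Hs Ha]].
  { inner_expand. lra. }
  destruct (boundary_exit x y2 (N y2 ⊖ N y1) Hx Hy2) as [s' [Hs' Hb]].
  { inner_expand. rewrite (hs_inner_sym _ (N y2) (N y1)). lra. }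
  set (a := x ⊕ s ⊙ (N y1 ⊖ N y2)) in *. set (b := x ⊕ s' ⊙ (N y2 ⊖ N y1)) in *.
  destruct (gradient_decrease F a (N a) (x ⊖ a) (Hgrad a Ha)
    (normal_interior a x _ (HN a Ha) Hx)) as [d [Hd Hdec]].
  assert (Hmin : 0 < Rmin d 1) by (apply Rmin_pos; lra).
  assert (Hl := Rmin_l d 1). assert (Hr := Rmin_r d 1).
  set (t := Rmin d 1 / 2). assert (Ht : 0 < t < 1) by (unfold t; lra).
  specialize (Hdec t ltac:(unfold t; lra)). rewrite (HF1 a Ha) in Hdec.
  assert (Hden : 0 < (1 - t) * s + s') by nra.
  (* The weight that balances the offsets (1 - t) s and s' of the two points on either side of x. *)
  set (l := s' / ((1 - t) * s + s')).
  assert (Hl0 : 0 < l) by now apply Rdiv_lt_0_compat.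
  assert (Hl1 : l <= 1).
  { apply Rmult_le_reg_r with ((1 - t) * s + s'); [easy|].
    unfold l, Rdiv. rewrite Rmult_assoc, Rinv_l by lra. nra. }
  assert (H := HF (a ⊕ t ⊙ (x ⊖ a)) b l ltac:(lra)).
  replace (l ⊙ (a ⊕ t ⊙ (x ⊖ a)) ⊕ (1 - l) ⊙ b) with x in H.
  2:{ unfold a, b, l. vec. lra. }
  rewrite (HF1 b Hb) in H. nra.
Qed.

(** * Construction of the defining function *)

Section Construction.
Context (Hphi : forall t, 0 <= t -> exists pr : Riemann_integrable w 0 t, RiemannInt pr = phi t).
Context (M : R) (HM : 0 < M).
Context (H3 : forall x y, hboundary V x -> hboundary V y ->
  ⟨N y, y ⊖ x⟩ >= ‖(N x ⊖ N y)‖ / 2 * omega_inv w (‖(N x ⊖ N y)‖ / (4 * M))).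

(** With d = |N z - N y|, r = |x - y| and s the inverse modulus of d / (4M), the tangents differ by
    at most d r - d s / 2. This is nonpositive if s >= 2r; otherwise d <= 4M w(2r) <= 8M w(r), and r
    w(r) <= 4 phi(r) produces the 32. *)
Lemma tangent_below_upper_bound y z x : hboundary V y -> hboundary V z ->
  ⟨N z, x ⊖ z⟩ <= ⟨N y, x ⊖ y⟩ + 32 * M * phi ‖(x ⊖ y)‖.
Proof.
  intros Hy Hz. assert (H := H3 y z Hy Hz). rewrite norm_sub_sym in H.
  set (d := ‖(N z ⊖ N y)‖) in *. set (r := ‖(x ⊖ y)‖).
  assert (Hd : 0 <= d) by apply norm_nonneg. assert (Hr : 0 <= r) by apply norm_nonneg.
  assert (HdM : 0 <= d / (4 * M)).
  { apply Rmult_le_pos; [easy|]. left. apply Rinv_0_lt_compat. lra. }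
  destruct (omega_inv_spec Hw _ HdM) as [Hs Hws].
  set (s := omega_inv w (d / (4 * M))) in *.
  assert (Hcs := cauchy_schwarz (N z ⊖ N y) (x ⊖ y)). fold d r in Hcs.
  assert (Hphir := integral_nonneg Hw Hphi r Hr).
  assert (Hmain : ⟨N z, x ⊖ z⟩ - ⟨N y, x ⊖ y⟩ <= d * r - d / 2 * s).
  { revert Hcs H. inner_expand. lra. }
  destruct (Rle_or_lt (2 * r) s) as [Hrs|Hrs].
  - assert (0 <= M * phi r) by (apply Rmult_le_pos; lra).
    assert (d * r <= d * (s / 2)) by (apply Rmult_le_compat_l; lra). lra.
  - assert (Hd' : d = 4 * M * w s) by (rewrite Hws; field; lra).
    assert (H1 := modulus_mono Hw s (2 * r) Hs ltac:(lra)).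
    assert (H2 := modulus_scale_le Hw 2 r ltac:(lra) Hr).
    assert (H4 := integral_ge Hw Hphi r Hr).
    assert (Hds : d * r <= 8 * M * (r * w r)).
    { rewrite Hd'. replace (8 * M * (r * w r)) with (4 * M * (2 * w r) * r) by ring.
      apply Rmult_le_compat_r; [easy|]. apply Rmult_le_compat_l; lra. }
    assert (8 * M * (r * w r) <= 8 * M * (4 * phi r)) by (apply Rmult_le_compat_l; lra).
    assert (0 <= d / 2 * s) by (apply Rmult_le_pos; lra). lra.
Qed.

Lemma normal_inequality_function : exists F : X -> R, convex_fun F /\ C1omega w F /\
  (forall x, hboundary V x <-> F x = 1) /\ (forall x, hboundary V x -> has_gradient F x (N x)).
Proof.
  destruct (classic (exists y1 y2, hboundary V y1 /\ hboundary V y2 /\ N y1 <> N y2))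
    as [(y1 & y2 & Hy1 & Hy2 & Hne)|Hconst].
  2:{ destruct (classic (exists y0, hboundary V y0)) as [[y0 Hy0]|Hempty].
    - apply (half_space_function y0 Hy0). intros y Hy. apply NNPP. intros Hne.
      apply Hconst. now exists y, y0.
    (* Without boundary points any constant other than 1 serves; writing it as an affine function
       reuses the affine lemmas. *)
    - exists (fun x => 0 + ⟨@hs_zero X, x ⊖ hs_zero⟩). split; [apply affine_convex|].
      split; [|split].
      + exists (fun _ => hs_zero), 1. split; [lra|]. split; [intros x; apply affine_gradient|].
        intros x y. replace (@hs_zero X ⊖ hs_zero) with (@hs_zero X) by vec. rewrite norm_zero.
        assert (H := modulus_nonneg Hw _ (norm_nonneg (x ⊖ y))). lra.
      + intros x. rewrite inner_zero_l. split; [|lra]. intros Hx. destruct Hempty. now exists x.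
      + intros x Hx. destruct Hempty. now exists x. }
  set (b y x := 1 + ⟨N y, x ⊖ y⟩ + 32 * M * phi ‖(x ⊖ y)‖).
  set (B f := exists y, hboundary V y /\ f = b y).
  assert (Htan : forall z f x, hboundary V z -> B f -> 1 + ⟨N z, x ⊖ z⟩ <= f x).
  { intros z f x Hz (y & Hy & ->). unfold b.
    assert (H := tangent_below_upper_bound y z x Hy Hz). lra. }
  destruct (largest_convex_minorant_exists B (fun x => 1 + ⟨N y1, x ⊖ y1⟩) (b y1))
    as [F HF].
  { apply affine_convex. }
  { intros f x Hf. now apply Htan. }
  { now exists y1. }
  (* Here 128 is 4 times the coefficient 32 of [phi]; the affine part of [b] has vanishing second
     differences. *)
  assert (Hdiff : forall x h, F (x ⊕ h) + F (x ⊖ h) - 2 * F x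
    <= 128 * M * (‖(h)‖ * w ‖(h)‖)).
  { intros x h. apply (largest_convex_minorant_second_difference B F h _ HF).
    intros f z (y & Hy & ->). unfold b.
    assert (H := integral_norm_second_difference Hw Hphi (z ⊖ y) h).
    replace (z ⊖ y ⊕ h) with (z ⊕ h ⊖ y) in H by vec.
    replace (z ⊖ y ⊖ h) with (z ⊖ h ⊖ y) in H by vec.
    apply Rmult_le_compat_l with (r := 32 * M) in H; [|lra].
    revert H. generalize (phi ‖(z ⊕ h ⊖ y)‖) (phi ‖(z ⊖ h ⊖ y)‖) (phi ‖(z ⊖ y)‖).
    intros. inner_expand. lra. }
  destruct HF as (Hconv & Hle & Hmax).
  assert (HFtan : forall z x, hboundary V z -> 1 + ⟨N z, x ⊖ z⟩ <= F x).
  { intros z x Hz. apply (Hmax (fun x => 1 + ⟨N z, x ⊖ z⟩)); [apply affine_convex|].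
    intros f y Hf. now apply Htan. }
  assert (HF1 : forall y, hboundary V y -> F y = 1).
  { intros y Hy. apply Rle_antisym.
    - assert (H := Hle (b y) y ltac:(now exists y)). revert H. unfold b.
      replace (y ⊖ y) with (@hs_zero X) by vec.
      rewrite norm_zero, inner_zero_r, (integral_zero phi Hphi). lra.
    - assert (H := HFtan y y Hy). revert H. replace (y ⊖ y) with (@hs_zero X) by vec.
      rewrite inner_zero_r. lra. }
  assert (Hgrad : forall y, hboundary V y -> has_gradient F y (N y)).
  { intros y Hy. apply (subgradient_has_gradient Hw F (128 * M) ltac:(lra) Hdiff).
    intros x. rewrite (HF1 y Hy). now apply HFtan. }
  exists F. split; [easy|]. split; [|split; [|easy]].
  - apply (second_difference_C1omega Hw F (128 * M) Hconv ltac:(lra) Hdiff).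
    (* A single upper function, [b y1], bounds F on the unit ball about x. *)
    intros x. set (r := ‖(x ⊖ y1)‖ + 1). exists (1 + r + 32 * M * phi r).
    intros v Hv. eapply Rle_trans; [apply (Hle (b y1)); now exists y1|]. unfold b.
    assert (Hxv : ‖(x ⊕ v ⊖ y1)‖ <= r).
    { replace (x ⊕ v ⊖ y1) with (x ⊖ y1 ⊕ v) by vec.
      eapply Rle_trans; [apply norm_triangle|]. unfold r. lra. }
    assert (H := integral_mono Hw Hphi _ r (norm_nonneg _) Hxv).
    apply Rmult_le_compat_l with (r := 32 * M) in H; [|lra].
    assert (Hcs := cauchy_schwarz (N y1) (x ⊕ v ⊖ y1)). rewrite (normal_norm y1 Hy1) in Hcs.
    lra.
  - intros x. split; [apply HF1|]. intros Hx.
    assert (HVx : V x).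
    { apply NNPP. intros Hno. destruct (exists_separating_normal HV N x HN Hno) as [y [Hy Hs]].
      assert (H := HFtan y x Hy). lra. }
    split; [now apply closure_in|]. intros Hint.
    assert (H := convex_lt_1_interior F y1 y2 x Hconv HF1 Hgrad Hy1 Hy2 Hne Hint). lra.
Qed.

End Construction.

(** * From a defining function back to the modulus of the normal *)

Lemma function_normal_modulus (F : X -> R) : C1omega w F ->
  (forall x, hboundary V x -> has_gradient F x (N x)) ->
  exists M, 0 < M /\ forall x y, hboundary V x -> hboundary V y ->
    ‖(N x ⊖ N y)‖ <= M * w ‖(x ⊖ y)‖.
Proof.
  intros (G & K & HK & HG & Hmod) Hgrad. exists K. split; [easy|]. intros x y Hx Hy.
  rewrite (gradient_unique F x (N x) (G x)), (gradient_unique F y (N y) (G y)) by auto.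
  apply Hmod.
Qed.

Lemma gradient_line_continuous (F : X -> R) (G : X -> X) x v :
  (forall z, has_gradient F z (G z)) -> continuity (fun t => F (x ⊕ t ⊙ v)).
Proof.
  intros HG s eps Heps. set (p := x ⊕ s ⊙ v).
  destruct (HG p 1 Rlt_0_1) as [d [Hd H]].
  assert (Hv := norm_nonneg v). assert (Hg := norm_nonneg (G p)).
  set (L := (‖(G p)‖ + 1) * (‖(v)‖ + 1)).
  assert (HL : 0 < L) by (unfold L; nra).
  exists (Rmin (d / (‖(v)‖ + 1)) (eps / L)). split.
  { apply Rmin_pos; apply Rdiv_lt_0_compat; lra. }
  intros t [_ Ht]. simpl in *. unfold Rdist in *.
  assert (Ht1 : Rabs (t - s) * (‖(v)‖ + 1) < d).
  { replace d with (d / (‖(v)‖ + 1) * (‖(v)‖ + 1)) by (field; lra).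
    apply Rmult_lt_compat_r; [lra|]. eapply Rlt_le_trans; [apply Ht|apply Rmin_l]. }
  assert (Ht2 : Rabs (t - s) * L < eps).
  { replace eps with (eps / L * L) by (field; lra).
    apply Rmult_lt_compat_r; [easy|]. eapply Rlt_le_trans; [apply Ht|apply Rmin_r]. }
  set (h := (t - s) ⊙ v).
  assert (Hh : ‖(h)‖ = Rabs (t - s) * ‖(v)‖) by apply norm_scal.
  assert (Hts := Rabs_pos (t - s)).
  specialize (H h ltac:(rewrite Hh; lra)).
  replace (p ⊕ h) with (x ⊕ t ⊙ v) in H by (unfold p, h; vec).
  assert (Hcs := cauchy_schwarz_abs (G p) h).
  assert (HhL : (‖(G p)‖ + 1) * ‖(h)‖ <= Rabs (t - s) * L).
  { rewrite Hh. unfold L.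
    replace ((‖(G p)‖ + 1) * (Rabs (t - s) * ‖(v)‖))
      with (Rabs (t - s) * ((‖(G p)‖ + 1) * ‖(v)‖)) by ring.
    apply Rmult_le_compat_l; [easy|]. apply Rmult_le_compat_l; lra. }
  apply Rabs_le_inv in H, Hcs. apply Rabs_def1; fold p; lra.
Qed.

(* [F - 1] has a constant sign on the interior of [V], so [V] lies on the same side of the level
   set of [F] at all of its points. *)
Lemma level_set_normal_sign (F : X -> R) (G : X -> X) :
  convex_fun F -> (forall x, has_gradient F x (G x)) -> (forall x, hboundary V x <-> F x = 1) ->
  (forall x, hboundary V x -> G x <> hs_zero) ->
  exists s, Rabs s = 1 /\ forall x, hboundary V x -> N x = s ⊙ (/ ‖(G x)‖ ⊙ G x).
Proof.
  intros HF HG HF1 Hne. destruct (proj2 (proj2 HV)) as [z Hz].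
  assert (Hpar : forall x, hboundary V x -> exists c, c <> 0 /\ G x = c ⊙ N x).
  { intros x Hx. apply (gradient_parallel_normal HV F x (G x) (N x) 1); auto; [lra|].
    intros y _ Hy. apply HF1 in Hx, Hy. lra. }
  assert (Hscale : forall x c, hboundary V x -> G x = c ⊙ N x -> ‖(G x)‖ = Rabs c).
  { intros x c Hx ->. rewrite norm_scal, (normal_norm x Hx). ring. }
  assert (Hz1 : F z <> 1).
  { intros E. apply HF1 in E. now apply (proj2 E). }
  destruct (Rlt_or_le (F z) 1) as [Hlt|Hge].
  - exists 1. split; [apply Rabs_R1|]. intros x Hx. destruct (Hpar x Hx) as [c [Hc HGc]].
    assert (Hzx := normal_interior x z (N x) (HN x Hx) Hz).
    assert (H := convex_above_tangent F x z (G x) HF (HG x)).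
    rewrite (proj1 (HF1 x) Hx), HGc, hs_inner_scal_l in H.
    assert (Hc0 : 0 < c) by nra.
    rewrite (Hscale x c Hx HGc), Rabs_pos_eq, HGc by lra. vec. lra.
  (* Here F z > 1. If F decreased from x towards z, it would fall below 1 and return to 1 before z,
     by the intermediate value theorem; but that point of the open segment is interior to V, not on
     its boundary. *)
  - exists (- (1)). split; [rewrite Rabs_Ropp; apply Rabs_R1|].
    intros x Hx. destruct (Hpar x Hx) as [c [Hc HGc]].
    assert (Hzx := normal_interior x z (N x) (HN x Hx) Hz).
    assert (H : 0 <= ⟨G x, z ⊖ x⟩).
    { apply Rnot_lt_le. intros Hneg.
      destruct (gradient_decrease F x (G x) (z ⊖ x) (HG x) Hneg) as [d [Hd Hdec]].
      assert (Hmin : 0 < Rmin d 1) by (apply Rmin_pos; lra).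
      assert (Hl := Rmin_l d 1). assert (Hr := Rmin_r d 1).
      specialize (Hdec (Rmin d 1 / 2) ltac:(lra)). rewrite (proj1 (HF1 x) Hx) in Hdec.
      destruct (IVT (fun t => F (x ⊕ t ⊙ (z ⊖ x)) - 1) (Rmin d 1 / 2) 1) as [t [Ht Ht1]].
      - apply continuity_minus; [now apply (gradient_line_continuous F G)|].
        apply continuity_const. now intros ? ?.
      - lra.
      - lra.
      - replace (x ⊕ 1 ⊙ (z ⊖ x)) with z by vec. lra.
      - assert (HSt : hboundary V (x ⊕ t ⊙ (z ⊖ x))) by (apply HF1; lra).
        apply (proj2 HSt). apply interior_segment; [easy|now apply boundary_in|easy|lra]. }
    rewrite HGc, hs_inner_scal_l in H.
    assert (Hc0 : c < 0) by nra.
    rewrite (Hscale x c Hx HGc), Rabs_left, HGc by lra. vec. lra.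
Qed.

Lemma hypersurface_normal_modulus : convex_hypersurface_C1omega w (hboundary V) ->
  exists M, 0 < M /\ forall x y, hboundary V x -> hboundary V y ->
    ‖(N x ⊖ N y)‖ <= M * w ‖(x ⊖ y)‖.
Proof.
  intros (M & HM & F & HF & (G & K & HK & HG & Hmod) & HF1 & Hbd).
  assert (HGM : forall x, hboundary V x -> / M <= ‖(G x)‖).
  { intros x Hx. now apply (Hbd x (G x) Hx). }
  assert (HiM : 0 < / M) by now apply Rinv_0_lt_compat.
  destruct (level_set_normal_sign F G HF HG HF1) as [s [Hs HNG]].
  { intros x Hx E. specialize (HGM x Hx). rewrite E, norm_zero in HGM. lra. }
  exists (2 * K * M). split; [repeat apply Rmult_lt_0_compat; lra|].
  intros x y Hx Hy. rewrite (HNG x Hx), (HNG y Hy).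
  replace (s ⊙ (/ ‖(G x)‖ ⊙ G x) ⊖ s ⊙ (/ ‖(G y)‖ ⊙ G y))
    with (s ⊙ (/ ‖(G x)‖ ⊙ G x ⊖ / ‖(G y)‖ ⊙ G y)).
  2:{ apply vec_ext. intros z. inner_expand. ring. }
  rewrite norm_scal, Hs, Rmult_1_l.
  assert (HGx := HGM x Hx). assert (HGy := HGM y Hy).
  eapply Rle_trans; [apply norm_normalize_dist; lra|].
  assert (Hxy := Hmod x y). assert (Hwr := modulus_nonneg Hw _ (norm_nonneg (x ⊖ y))).
  replace (2 * K * M * w ‖(x ⊖ y)‖) with (2 * (K * w ‖(x ⊖ y)‖) * M) by ring.
  apply Rmult_le_compat; try lra.
  - assert (H := norm_nonneg (G x ⊖ G y)). lra.
  - left. apply Rinv_0_lt_compat. lra.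
  - rewrite <- (Rinv_inv M). apply Rinv_le_contravar; lra.
Qed.

End Equivalences.
(** * The Minkowski functional *)

Lemma subgradient_eq_gradient {X : HilbertSpace} (f : X -> R) (x g a : X) :
  has_gradient f x a -> (forall y, f x + ⟨g, y ⊖ x⟩ <= f y) -> a = g.
Proof.
  intros Ha Hg.
  assert (Hle : forall v, ⟨g, v⟩ <= ⟨a, v⟩).
  { intros v. apply Rnot_lt_le. intros Hlt.
    destruct (gradient_along f x a v Ha ((⟨g, v⟩ - ⟨a, v⟩) / 2)) as [d [Hd H]]; [lra|].
    specialize (H (d / 2) ltac:(lra)). apply Rabs_le_inv in H.
    assert (H' := Hg (x ⊕ (d / 2) ⊙ v)).
    replace (x ⊕ (d / 2) ⊙ v ⊖ x) with ((d / 2) ⊙ v) in H' by vec.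
    rewrite inner_scal_r in H'. nra. }
  apply vec_ext. intros v. apply Rle_antisym; [|apply Hle].
  assert (H := Hle ((-1) ⊙ v)). rewrite !inner_scal_r in H. lra.
Qed.

Section Minkowski.
Context {X : HilbertSpace} {V : X -> Prop} {N : X -> X}.
Context (HV : hconvex_body V).
Context (HN : forall x, hboundary V x -> outer_unit_normal V x (N x)).
Context (rho : R) (Hrho : 0 < rho) (Hball : forall v, ‖(v)‖ <= rho -> V v).
Implicit Types (x y z p v : X).

Lemma zero_in : V hs_zero.
Proof. apply Hball. rewrite norm_zero. lra. Qed.

Lemma zero_interior : hinterior V hs_zero.
Proof.
  exists rho. split; [easy|]. intros z Hz. apply Hball. unfold hball in Hz.
  replace (z ⊖ hs_zero) with z in Hz by vec. lra.
Qed.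

Lemma minkowski_is_inf x : is_inf (fun t => 0 < t /\ V (/ t ⊙ x)) (minkowski V x).
Proof.
  apply (epsilon_spec (inhabits 0) (is_inf (fun t => 0 < t /\ V (/ t ⊙ x)))).
  (* The infimum is obtained as the supremum of the negated set, nonempty because V contains a ball
     about 0. *)
  destruct (completeness (fun m => 0 < - m /\ V (/ - m ⊙ x))) as [m [Hub Hlub]].
  - exists 0. intros t [Ht _]. lra.
  - assert (Hx := norm_nonneg x).
    assert (Ht : 0 < (‖(x)‖ + 1) / rho) by (apply Rdiv_lt_0_compat; lra).
    exists (- ((‖(x)‖ + 1) / rho)). rewrite Ropp_involutive. split; [easy|].
    apply Hball. rewrite norm_scal_pos by (left; now apply Rinv_0_lt_compat).
    apply Rmult_le_reg_l with ((‖(x)‖ + 1) / rho); [easy|].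
    rewrite <- Rmult_assoc, Rinv_r by lra.
    replace ((‖(x)‖ + 1) / rho * rho) with (‖(x)‖ + 1) by (field; lra). lra.
  - exists (- m). split.
    + intros t [Ht HVt]. enough (- t <= m) by lra. apply Hub.
      now rewrite Ropp_involutive.
    + intros c Hc. enough (m <= - c) by lra. apply Hlub. intros t Ht.
      specialize (Hc (- t) Ht). lra.
Qed.

Lemma minkowski_nonneg x : 0 <= minkowski V x.
Proof. apply (minkowski_is_inf x). intros t [Ht _]. lra. Qed.

Lemma minkowski_le x t : 0 < t -> V (/ t ⊙ x) -> minkowski V x <= t.
Proof. intros Ht HVt. now apply (minkowski_is_inf x). Qed.

Lemma minkowski_lt_in x t : minkowski V x < t -> V (/ t ⊙ x).
Proof.
  intros Ht.
  assert (Hex : exists s, (0 < s /\ V (/ s ⊙ x)) /\ s < t).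
  { apply NNPP. intros Hno. enough (t <= minkowski V x) by lra.
    apply (minkowski_is_inf x). intros s Hs. apply Rnot_lt_le. intros Hst.
    apply Hno. now exists s. }
  destruct Hex as (s & [Hs HVs] & Hst).
  replace (/ t ⊙ x) with (hs_zero ⊕ (s / t) ⊙ (/ s ⊙ x ⊖ hs_zero)) by (vec; lra).
  apply (convex_body_along HV); [apply zero_in|easy|]. split.
  - apply Rmult_le_pos; [lra|]. left. apply Rinv_0_lt_compat. lra.
  - apply Rmult_le_reg_r with t; [lra|]. unfold Rdiv. rewrite Rmult_assoc, Rinv_l; lra.
Qed.

(** Shrinking the point slightly puts it into V; were it interior, a slightly stretched copy would
    also lie in V and force a smaller gauge. *)
Lemma minkowski_projection x : 0 < minkowski V x -> hboundary V (/ minkowski V x ⊙ x).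
Proof.
  intros Hm. set (m := minkowski V x) in *. set (y := / m ⊙ x).
  assert (Hy := norm_nonneg y). split.
  - intros r Hr. set (e := r / (‖(y)‖ + 1)).
    assert (He : 0 < e) by (apply Rdiv_lt_0_compat; lra).
    exists (/ ((1 + e) * m) ⊙ x). split; [apply minkowski_lt_in; fold m; nra|].
    unfold hball. replace (/ ((1 + e) * m) ⊙ x ⊖ y) with ((- (e / (1 + e))) ⊙ y)
      by (unfold y; vec; lra).
    assert (He1 : 0 <= e / (1 + e)) by (left; apply Rdiv_lt_0_compat; lra).
    assert (He2 : e / (1 + e) <= e).
    { apply Rmult_le_reg_r with (1 + e); [lra|]. unfold Rdiv. rewrite Rmult_assoc, Rinv_l; nra. }
    rewrite norm_scal, Rabs_Ropp, Rabs_pos_eq by easy.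
    apply Rle_lt_trans with (e * ‖(y)‖); [now apply Rmult_le_compat_r|].
    replace r with (e * (‖(y)‖ + 1)) by (unfold e; field; lra). nra.
  - intros Hint. destruct (interior_shift y y Hint) as [e [He HVe]].
    replace (y ⊕ e ⊙ y) with (/ (m / (1 + e)) ⊙ x) in HVe by (unfold y; vec; lra).
    assert (H := minkowski_le x (m / (1 + e)) ltac:(apply Rdiv_lt_0_compat; lra) HVe).
    fold m in H. apply Rmult_le_compat_r with (r := 1 + e) in H; [|lra].
    unfold Rdiv in H. rewrite Rmult_assoc, Rinv_l in H by lra. nra.
Qed.

Lemma minkowski_boundary x : hboundary V x -> minkowski V x = 1.
Proof.
  intros Hx. apply Rle_antisym.
  { apply minkowski_le; [lra|]. replace (/ 1 ⊙ x) with x by vec. now apply (boundary_in HV). }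
  apply Rnot_lt_le. intros Hlt. apply (proj2 Hx).
  assert (Hm := minkowski_nonneg x).
  set (t := (minkowski V x + 1) / 2). assert (Ht : 0 < t < 1) by (unfold t; lra).
  assert (HVt : V (/ t ⊙ x)) by (apply minkowski_lt_in; unfold t; lra).
  replace x with (/ t ⊙ x ⊕ (1 - t) ⊙ (hs_zero ⊖ / t ⊙ x)) by (vec; lra).
  apply (interior_segment HV); [easy|apply zero_interior|lra].
Qed.

(** V contains [rho ⊙ N y]. The uniform lower bound is what permits dividing by ⟨N y, y⟩. *)
Lemma normal_radial y : hboundary V y -> rho <= ⟨N y, y⟩.
Proof.
  intros Hy. assert (Hn := HN y Hy).
  assert (HVn : V (rho ⊙ N y)).
  { apply Hball. rewrite norm_scal_pos, (proj1 Hn) by lra. lra. }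
  assert (H := proj2 Hn _ HVn). revert H. inner_expand. rewrite (normal_unit y _ Hn). lra.
Qed.

(** Represents the linear functional equal to 1 on the supporting hyperplane at the radial
    projection of x. *)
Definition minkowski_gradient x : X :=
  let y := / minkowski V x ⊙ x in / ⟨N y, y⟩ ⊙ N y.

Lemma minkowski_above_tangent x y : 0 < minkowski V x ->
  minkowski V x + ⟨minkowski_gradient x, y ⊖ x⟩ <= minkowski V y.
Proof.
  intros Hm. assert (HSp := minkowski_projection x Hm). unfold minkowski_gradient.
  set (m := minkowski V x) in *. set (p := / m ⊙ x) in *. cbv zeta.
  assert (Hp := normal_radial p HSp). set (s := ⟨N p, p⟩) in *.
  assert (Hx : ⟨N p, x⟩ = m * s).
  { replace x with (m ⊙ p) by (unfold p; vec; lra). apply inner_scal_r. }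
  (* By homogeneity the tangent at x is a linear functional, at most 1 on V and hence at most the
     gauge. *)
  assert (Heq : m + ⟨/ s ⊙ N p, y ⊖ x⟩ = / s * ⟨N p, y⟩).
  { rewrite hs_inner_scal_l, inner_sub_r, Hx. field. lra. }
  rewrite Heq.
  apply (minkowski_is_inf y). intros t [Ht HVt].
  assert (H := proj2 (HN p HSp) _ HVt). rewrite inner_sub_r, inner_scal_r in H. fold s in H.
  apply Rmult_le_reg_l with (s * / t); [apply Rmult_lt_0_compat; [lra|now apply Rinv_0_lt_compat]|].
  replace (s * / t * (/ s * ⟨N p, y⟩)) with (/ t * ⟨N p, y⟩) by (field; lra).
  replace (s * / t * t) with s by (field; lra). lra.
Qed.

Lemma minkowski_gradient_norm x : 0 < minkowski V x ->
  let y := / minkowski V x ⊙ x in ‖(minkowski_gradient x)‖ = / ⟨N y, y⟩.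
Proof.
  intros Hm y. assert (HSy := minkowski_projection x Hm). fold y in HSy.
  assert (Hy := normal_radial y HSy). unfold minkowski_gradient. fold y.
  rewrite norm_scal_pos, (proj1 (HN y HSy)) by (left; apply Rinv_0_lt_compat; lra). ring.
Qed.

Lemma minkowski_lipschitz x y : rho * (minkowski V x - minkowski V y) <= ‖(x ⊖ y)‖.
Proof.
  destruct (minkowski_nonneg x) as [Hm|Hm].
  2:{ assert (H := minkowski_nonneg y). assert (H' := norm_nonneg (x ⊖ y)). nra. }
  assert (H := minkowski_above_tangent x y Hm).
  assert (Hn := minkowski_gradient_norm x Hm). cbv zeta in Hn.
  assert (Hr := normal_radial _ (minkowski_projection x Hm)).
  set (s := ⟨N (/ minkowski V x ⊙ x), / minkowski V x ⊙ x⟩) in *.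
  assert (Hcs := cauchy_schwarz_abs (minkowski_gradient x) (y ⊖ x)).
  rewrite (norm_sub_sym y), Hn in Hcs. apply Rabs_le_inv in Hcs.
  assert (Hxy := norm_nonneg (x ⊖ y)).
  assert (Hle : minkowski V x - minkowski V y <= / rho * ‖(x ⊖ y)‖).
  { assert (/ s * ‖(x ⊖ y)‖ <= / rho * ‖(x ⊖ y)‖); [|lra].
    apply Rmult_le_compat_r; [easy|]. apply Rinv_le_contravar; lra. }
  apply Rmult_le_compat_l with (r := rho) in Hle; [|lra].
  rewrite <- Rmult_assoc, Rinv_r in Hle by lra. lra.
Qed.

(** * The gauge of a bounded body *)

Context (D : R) (HD : 0 < D) (Hbounded : forall x, V x -> ‖(x)‖ <= D).
Context {w : R -> R} (Hw : modulus w).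

Lemma minkowski_projection_lipschitz alpha x y : 0 < alpha ->
  alpha <= minkowski V x -> alpha <= minkowski V y ->
  ‖(/ minkowski V x ⊙ x ⊖ / minkowski V y ⊙ y)‖ <= (1 + D / rho) / alpha * ‖(x ⊖ y)‖.
Proof.
  intros Ha Hx Hy. set (q := / minkowski V y ⊙ y).
  assert (Hq : ‖(q)‖ <= D).
  { apply Hbounded, (boundary_in HV), minkowski_projection. lra. }
  set (m := minkowski V x) in *. set (m' := minkowski V y) in *.
  assert (Hl1 := minkowski_lipschitz x y). assert (Hl2 := minkowski_lipschitz y x).
  fold m m' in Hl1, Hl2. rewrite (norm_sub_sym y) in Hl2. set (r := ‖(x ⊖ y)‖) in *.
  assert (Hr : 0 <= r) by apply norm_nonneg.
  assert (Hmm : Rabs (m' - m) <= r / rho).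
  { assert (Hi : r = rho * (r / rho)) by (field; lra).
    apply Rabs_le. split; apply Rmult_le_reg_l with rho; lra. }
  replace (/ m ⊙ x ⊖ q) with (/ m ⊙ (x ⊖ y ⊕ (m' - m) ⊙ q)) by (unfold q; vec; lra).
  rewrite norm_scal_pos by (left; apply Rinv_0_lt_compat; lra).
  replace ((1 + D / rho) / alpha * r) with (/ alpha * (r + r / rho * D)) by (field; lra).
  apply Rmult_le_compat; [left; apply Rinv_0_lt_compat; lra|apply norm_nonneg| |].
  - apply Rinv_le_contravar; lra.
  - eapply Rle_trans; [apply norm_triangle|]. rewrite norm_scal.
    apply Rplus_le_compat_l. apply Rmult_le_compat; try easy.
    + apply Rabs_pos.
    + apply norm_nonneg.
Qed.

Lemma minkowski_gradient_modulus M alpha : 0 < M -> 0 < alpha ->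
  (forall x y, hboundary V x -> hboundary V y -> ‖(N x ⊖ N y)‖ <= M * w ‖(x ⊖ y)‖) ->
  exists K, 0 < K /\ forall x y, alpha <= minkowski V x -> alpha <= minkowski V y ->
    ‖(minkowski_gradient x ⊖ minkowski_gradient y)‖ <= K * w ‖(x ⊖ y)‖.
Proof.
  intros HM Ha H1.
  (* [c1] exceeds the Lipschitz constant of the radial projection by 1 so that [modulus_scale_le]
     applies. [c2] converts a distance r <= 2D between boundary points into r <= c2 w(r), by
     concavity. *)
  set (c1 := (1 + D / rho) / alpha + 1). set (c2 := 2 * D / w (2 * D)).
  assert (HDr : 0 < D / rho) by now apply Rdiv_lt_0_compat.
  assert (Hc1 : 1 < c1).
  { enough (0 < (1 + D / rho) / alpha) by (unfold c1; lra). apply Rdiv_lt_0_compat; lra. }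
  assert (HwD := modulus_pos Hw (2 * D) ltac:(lra)).
  assert (Hc2 : 0 < c2) by (apply Rdiv_lt_0_compat; lra).
  assert (HMD : 0 < M * D) by now apply Rmult_lt_0_compat.
  set (c3 := / rho * (M + / rho * (M * D + c2))).
  assert (Hirho : 0 < / rho) by now apply Rinv_0_lt_compat.
  assert (Hc3 : 0 < c3).
  { apply Rmult_lt_0_compat; [easy|]. assert (0 < / rho * (M * D + c2)); [|lra].
    apply Rmult_lt_0_compat; lra. }
  exists (c3 * c1). split; [apply Rmult_lt_0_compat; lra|].
  intros x y Hx Hy.
  assert (Hproj := minkowski_projection_lipschitz alpha x y Ha Hx Hy).
  assert (HSp := minkowski_projection x ltac:(lra)).
  assert (HSq := minkowski_projection y ltac:(lra)).
  unfold minkowski_gradient. cbv zeta.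
  set (p := / minkowski V x ⊙ x) in *. set (q := / minkowski V y ⊙ y) in *.
  assert (Hp := normal_radial p HSp). assert (Hq := normal_radial q HSq).
  assert (Hpq := H1 p q HSp HSq).
  assert (HpD := Hbounded p (boundary_in HV p HSp)).
  assert (HqD := Hbounded q (boundary_in HV q HSq)).
  assert (Hnp := proj1 (HN p HSp)). assert (Hnq := proj1 (HN q HSq)).
  set (s := ⟨N p, p⟩) in *. set (s' := ⟨N q, q⟩) in *.
  set (r := ‖(p ⊖ q)‖) in *. set (R0 := ‖(x ⊖ y)‖) in *.
  assert (Hr : 0 <= r) by apply norm_nonneg. assert (HR0 : 0 <= R0) by apply norm_nonneg.
  assert (Hr2 : r <= 2 * D).
  { eapply Rle_trans; [apply norm_sub_triangle|]. lra. }
  assert (Hwr := modulus_nonneg Hw r Hr).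
  assert (Hrw : r <= c2 * w r).
  { assert (H := modulus_linear_le Hw r (2 * D) ltac:(lra) ltac:(lra)).
    apply Rmult_le_reg_r with (w (2 * D)); [easy|].
    replace (c2 * w r * w (2 * D)) with (2 * D * w r) by (unfold c2; field; lra). easy. }
  assert (HwR : w r <= c1 * w R0).
  { eapply Rle_trans; [apply (modulus_mono Hw r (c1 * R0) Hr)|].
    - unfold c1. lra.
    - apply modulus_scale_le; auto; lra. }
  set (d := ‖(N p ⊖ N q)‖) in *. assert (Hd : 0 <= d) by apply norm_nonneg.
  assert (Hss : Rabs (s' - s) <= d * D + r).
  { replace (s' - s) with (- (⟨N p ⊖ N q, q⟩ + ⟨N p, p ⊖ q⟩)).
    2:{ unfold s, s'. inner_expand. ring. }
    rewrite Rabs_Ropp. eapply Rle_trans; [apply Rabs_triang|].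
    apply Rplus_le_compat.
    - eapply Rle_trans; [apply cauchy_schwarz_abs|]. apply Rmult_le_compat_l; easy.
    - eapply Rle_trans; [apply cauchy_schwarz_abs|]. rewrite Hnp. fold r. lra. }
  replace (/ s ⊙ N p ⊖ / s' ⊙ N q) with (/ s ⊙ (N p ⊖ N q ⊕ (/ s' * (s' - s)) ⊙ N q))
    by (vec; lra).
  rewrite norm_scal_pos by (left; apply Rinv_0_lt_compat; lra).
  apply Rle_trans with (/ rho * (d + / rho * (d * D + r))).
  - apply Rmult_le_compat; [left; apply Rinv_0_lt_compat; lra|apply norm_nonneg| |].
    + apply Rinv_le_contravar; lra.
    + eapply Rle_trans; [apply norm_triangle|]. apply Rplus_le_compat_l.
      rewrite norm_scal, Hnq, Rmult_1_r, Rabs_mult.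
      rewrite (Rabs_pos_eq (/ s')) by (left; apply Rinv_0_lt_compat; lra).
      apply Rmult_le_compat; [left; apply Rinv_0_lt_compat; lra|apply Rabs_pos| |easy].
      apply Rinv_le_contravar; lra.
  - apply Rle_trans with (c3 * w r).
    + unfold c3. replace (/ rho * (M + / rho * (M * D + c2)) * w r)
        with (/ rho * (M * w r + / rho * (M * w r * D + c2 * w r))) by ring.
      apply Rmult_le_compat_l; [lra|]. apply Rplus_le_compat; [easy|].
      apply Rmult_le_compat_l; [lra|]. apply Rplus_le_compat; [|easy].
      apply Rmult_le_compat_r; lra.
    + rewrite Rmult_assoc. apply Rmult_le_compat_l; lra.
Qed.

Lemma normal_modulus_minkowski M alpha : 0 < M -> 0 < alpha ->
  (forall x y, hboundary V x -> hboundary V y -> ‖(N x ⊖ N y)‖ <= M * w ‖(x ⊖ y)‖) ->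
  exists (G : X -> X) K, 0 < K /\
    (forall x, alpha <= minkowski V x -> has_gradient (minkowski V) x (G x)) /\
    (forall x y, alpha <= minkowski V x -> alpha <= minkowski V y ->
       ‖(G x ⊖ G y)‖ <= K * w ‖(x ⊖ y)‖).
Proof.
  intros HM Ha H1.
  (* Halving [alpha] leaves room for x + h. The tangents at x and at x + h then trap the remainder
     between 0 and ⟨g' - g, h⟩, where g and g' are the gradients at x and x + h. *)
  destruct (minkowski_gradient_modulus M (alpha / 2) HM ltac:(lra) H1) as [K [HK Hmod]].
  exists minkowski_gradient, K. split; [easy|]. split.
  2:{ intros x y Hx Hy. apply Hmod; lra. }
  intros x Hx eps Heps.
  destruct (modulus_remainder_small (X := X) Hw K ltac:(lra) eps Heps) as [d [Hd Hsmall]].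
  exists (Rmin d (rho * (alpha / 2))). split; [apply Rmin_pos; nra|].
  intros h Hh.
  assert (Hh1 := Rlt_le_trans _ _ _ Hh (Rmin_l _ _)).
  assert (Hh2 := Rlt_le_trans _ _ _ Hh (Rmin_r _ _)).
  assert (Hlip := minkowski_lipschitz x (x ⊕ h)).
  replace ‖(x ⊖ (x ⊕ h))‖ with ‖(h)‖ in Hlip.
  2:{ rewrite norm_sub_sym. f_equal. vec. }
  assert (Hxh : alpha / 2 <= minkowski V (x ⊕ h)) by nra.
  assert (Hlow := minkowski_above_tangent x (x ⊕ h) ltac:(lra)).
  assert (Hup := minkowski_above_tangent (x ⊕ h) x ltac:(lra)).
  replace (x ⊕ h ⊖ x) with h in Hlow by vec.
  replace (x ⊖ (x ⊕ h)) with ((-1) ⊙ h) in Hup by vec. rewrite inner_scal_r in Hup.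
  specialize (Hmod (x ⊕ h) x Hxh ltac:(lra)).
  replace (x ⊕ h ⊖ x) with h in Hmod by vec.
  assert (Hcs := cauchy_schwarz (minkowski_gradient (x ⊕ h) ⊖ minkowski_gradient x) h).
  rewrite inner_sub_l in Hcs. specialize (Hsmall h Hh1).
  apply Rmult_le_compat_r with (r := ‖(h)‖) in Hmod; [|apply norm_nonneg].
  rewrite Rabs_pos_eq; lra.
Qed.

(** On the boundary, at gauge level 1, [G] is N x / ⟨N x, x⟩, of norm at least 1/D; normalizing it
    recovers N x. *)
Lemma minkowski_normal_modulus (G : X -> X) K : 0 < K ->
  (forall x, 1 <= minkowski V x -> has_gradient (minkowski V) x (G x)) ->
  (forall x y, 1 <= minkowski V x -> 1 <= minkowski V y ->
     ‖(G x ⊖ G y)‖ <= K * w ‖(x ⊖ y)‖) ->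
  forall x y, hboundary V x -> hboundary V y -> ‖(N x ⊖ N y)‖ <= 2 * K * D * w ‖(x ⊖ y)‖.
Proof.
  intros HK HG Hmod.
  assert (Heq : forall x, hboundary V x ->
    / D <= ‖(G x)‖ /\ N x = / ‖(G x)‖ ⊙ G x).
  { intros x Hx. assert (Hm := minkowski_boundary x Hx).
    assert (HGx : G x = minkowski_gradient x).
    { apply (subgradient_eq_gradient (minkowski V) x); [apply HG; lra|].
      intros y. apply minkowski_above_tangent. lra. }
    assert (Hn := minkowski_gradient_norm x ltac:(lra)). cbv zeta in Hn.
    rewrite <- HGx in Hn. unfold minkowski_gradient in HGx. cbv zeta in HGx.
    rewrite Hm in HGx, Hn. replace (/ 1 ⊙ x) with x in HGx, Hn by vec.
    assert (Hr := normal_radial x Hx).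
    assert (Hcs := cauchy_schwarz (N x) x). rewrite (proj1 (HN x Hx)) in Hcs.
    assert (HxD := Hbounded x (boundary_in HV x Hx)).
    rewrite Hn. split; [apply Rinv_le_contravar; lra|].
    rewrite HGx, Rinv_inv. vec. lra. }
  intros x y Hx Hy. destruct (Heq x Hx) as [HGx ->]. destruct (Heq y Hy) as [HGy ->].
  assert (HiD : 0 < / D) by now apply Rinv_0_lt_compat.
  eapply Rle_trans; [apply norm_normalize_dist; lra|].
  assert (Hxy := Hmod x y ltac:(rewrite minkowski_boundary by easy; lra)
    ltac:(rewrite minkowski_boundary by easy; lra)).
  replace (2 * K * D * w ‖(x ⊖ y)‖) with (2 * (K * w ‖(x ⊖ y)‖) * D) by ring.
  apply Rmult_le_compat; try lra.
  - assert (H := norm_nonneg (G x ⊖ G y)). lra.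
  - left. apply Rinv_0_lt_compat. lra.
  - rewrite <- (Rinv_inv D). apply Rinv_le_contravar; lra.
Qed.

End Minkowski.

Theorem theorem3p2 (X : HilbertSpace) (V : X -> Prop) (N : X -> X)
  (w : R -> R) (phi : R -> R)
  (HV : hconvex_body V)
  (HS : C1_hypersurface (hboundary V))
  (HN : forall x, hboundary V x -> outer_unit_normal V x (N x))
  (Hw : modulus w)
  (Hphi : forall t, 0 <= t -> exists pr : Riemann_integrable w 0 t, RiemannInt pr = phi t) :
  let S := hboundary V in
  let P1 := exists M, 0 < M /\ forall x y, S x -> S y ->
              hnorm (vsub (N x) (N y)) <= M * w (hnorm (vsub x y)) in
  let P2 := exists M, 0 < M /\ forall x, S x ->
              let W := fun p => hs_inner (N x) (vsub x p) >= M * phi (2 * hnorm (vsub x p)) in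
              (forall p, W p -> V p) /\ (forall p, (S p /\ W p) <-> p = x) in
  let P3 := exists M, 0 < M /\ forall x y, S x -> S y ->
              hs_inner (N y) (vsub y x) >=
                hnorm (vsub (N x) (N y)) / 2 * omega_inv w (hnorm (vsub (N x) (N y)) / (4 * M)) in
  let P4 := exists F : X -> R, convex_fun F /\ C1omega w F /\
              (forall x, S x <-> F x = 1) /\ (forall x, S x -> has_gradient F x (N x)) in
  let P5 := convex_hypersurface_C1omega w S in
  let P6 := forall alpha, 0 < alpha -> exists (G : X -> X) K, 0 < K /\
              (forall x, alpha <= minkowski V x -> has_gradient (minkowski V) x (G x)) /\
              (forall x y, alpha <= minkowski V x -> alpha <= minkowski V y ->
                 hnorm (vsub (G x) (G y)) <= K * w (hnorm (vsub x y))) in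
  (P1 <-> P2) /\ (P1 <-> P3) /\ (P1 <-> P4) /\ (P1 <-> P5) /\
  (hbounded_set V -> hinterior V (@hs_zero X) -> (P1 <-> P6)).
Proof.
  intros S P1 P2 P3 P4 P5 P6. unfold S in *. clear S.
  assert (H12 : P1 -> P2).
  { intros (M & HM & H1). exists (2 * M). split; [lra|].
    now apply (normal_modulus_interior_bodies HV HN Hw HS Hphi M). }
  assert (H23 : P2 -> P3).
  { intros (M & HM & H2). exists (2 * M). split; [lra|].
    apply (interior_bodies_normal_inequality HV HN Hw Hphi M HM).
    intros x Hx. apply (H2 x Hx). }
  assert (H31 : P3 -> P1).
  { intros (M & HM & H3). exists (4 * M). split; [lra|].
    now apply (normal_inequality_modulus Hw M). }
  assert (H34 : P3 -> P4).
  { intros (M & HM & H3). now apply (normal_inequality_function HV HN Hw Hphi M). }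
  assert (H41 : P4 -> P1).
  { intros (F & _ & HF & _ & Hgrad). now apply (function_normal_modulus F). }
  assert (H45 : P4 -> P5).
  { intros (F & HF & HC & HF1 & Hgrad). exists 1. split; [lra|]. exists F.
    split; [easy|]. split; [easy|]. split; [easy|]. intros x g Hx Hg.
    rewrite (gradient_unique F x g (N x)), (normal_norm HN x Hx) by auto. lra. }
  assert (H51 : P5 -> P1) by exact (hypersurface_normal_modulus HV HN Hw).
  split; [tauto|]. split; [tauto|]. split; [tauto|]. split; [tauto|].
  intros [B HB] [r [Hr Hint]].
  (* Interior points come with an open ball; half the radius gives a closed one. *)
  assert (Hball : forall v : X, hnorm v <= r / 2 -> V v).
  { intros v Hv. apply Hint. unfold hball.
    replace (vsub v hs_zero) with v by vec. lra. }
  assert (HD : 0 < Rmax B 1) by (eapply Rlt_le_trans; [apply Rlt_0_1|apply Rmax_r]).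
  assert (HVD : forall x, V x -> hnorm x <= Rmax B 1).
  { intros x Hx. eapply Rle_trans; [now apply HB|apply Rmax_l]. }
  split.
  - intros (M & HM & H1) alpha Ha.
    now apply (normal_modulus_minkowski HV HN (r / 2) ltac:(lra) Hball (Rmax B 1) HD HVD Hw M).
  - intros H6. destruct (H6 1 Rlt_0_1) as (G & K & HK & HG & Hmod).
    exists (2 * K * Rmax B 1). split; [repeat apply Rmult_lt_0_compat; lra|].
    now apply (minkowski_normal_modulus HV HN (r / 2) ltac:(lra) Hball (Rmax B 1) HD HVD G K).
Qed.
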